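(* Let $n\ge 2$ and let $H_n$ be an $n\times n$ real positive definite Hankel matrix. Then, for all integers $j\ge 1$ and $k\ge 0$ with $1\le j+2k\le n$, \[ \sigma_{j+2k}(H_n)\le 16\left[\exp\left(\frac{\pi^2}{4\log(8\lfloor n/2\rfloor/\pi)}\right)\right]^{-2k+2}\sigma_j(H_n), \] and, for every $0<\epsilon<1$, \[ \mathrm{rank}_\epsilon(H_n)\le 2\left\lceil\frac{2\log(8\lfloor n/2\rfloor/\pi)\,\log(16/\epsilon)}{\pi^2}\right\rceil+2. \] Both bounds hold for $n$ even or odd.
   Context: A Hankel matrix is a matrix $H_n$ with $(H_n)_{jk}=h_{j+k}$ for $1\le j,k\le n$ (constant along anti-diagonals). $\sigma_1(X)\ge\cdots\ge\sigma_n(X)\ge 0$ denote the singular values of an $n\times n$ matrix $X$, with the convention $\sigma_{n+1}(X)=0$, and $\|X\|_2=\sigma_1(X)$. For $0<\epsilon<1$, the $\epsilon$-rank is $\mathrm{rank}_\epsilon(X)=\min\{k\ge 0:\sigma_{k+1}(X)\le\epsilon\|X\|_2\}$. *)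

(* Defs.v *)
From mathcomp Require Import all_boot all_order all_algebra.
From mathcomp Require Import spectral sesquilinear complex polyrcf.
From mathcomp Require Import all_classical all_reals all_analysis.

Set Implicit Arguments.
Unset Strict Implicit.
Unset Printing Implicit Defensive.

Import Order.TTheory GRing.Theory Num.Theory.

Local Open Scope ring_scope.

(* Ordinals are numbered from 0: rows and columns are shifted to 1, ..., n. *)
Definition hankel (R : realType) (n : nat) (A : 'M[R]_n) : Prop :=
  exists h : nat -> R, forall i j : 'I_n, A i j = h (i.+1 + j.+1)%N.

Definition posdefmx (R : realType) (n : nat) (A : 'M[R]_n) : Prop :=
  A^T = A /\ forall x : 'cV[R]_n, x != 0 -> 0 < (x^T *m A *m x) 0 0.

(* Real eigenvalues, each repeated according to its algebraic multiplicity. *)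
Definition real_eigenvalues (R : realType) (n : nat) (A : 'M[R]_n) : seq R :=
  flatten [seq nseq (mup x (char_poly A)) x | x <- rootsR (char_poly A)].

(* In decreasing order; the list has length n by [size_singular_values]. *)
Definition singular_values (R : realType) (n : nat) (X : 'M[R]_n) : seq R :=
  sort >=%R [seq Num.sqrt x | x <- real_eigenvalues (X^T *m X)].

Lemma char_poly_similar (F : fieldType) (n : nat) (P A : 'M[F]_n) :
  P \in unitmx -> char_poly (invmx P *m A *m P) = char_poly A.
Proof.
move=> Pu; rewrite /char_poly.
have -> : char_poly_mx (invmx P *m A *m P)
    = map_mx polyC (invmx P) *m char_poly_mx A *m map_mx polyC P.
  rewrite /char_poly_mx mulmxBr mulmxBl !map_mxM scalar_mxC -(mulmxA 'X%:M).
  by rewrite -(map_mxM polyC (invmx P) P) mulVmx// map_mx1 mulmx1.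
rewrite !det_mulmx mulrC mulrA -det_mulmx -map_mxM mulmxV//.
by rewrite map_mx1 det1 mul1r.
Qed.

Lemma char_poly_sym_split (R : realType) (n : nat) (A : 'M[R]_n) :
  A^T = A -> exists s : seq R, char_poly A = \prod_(x <- s) ('X - x%:P).
Proof.
move=> symA; pose AC := map_mx (real_complex R) A : 'M[R[i]]_n.
have ACh : AC \is hermsymmx.
  apply: realsym_hermsym.
    apply/is_hermitianmxP; rewrite expr0 scale1r map_mx_id//.
    by apply/matrixP => i j; rewrite !mxE -[in LHS]symA mxE.
  by apply/mxOverP => i j; rewrite mxE; apply/complex_realP; exists (A i j).
have /hermitian_normalmx/orthomx_spectralP ACE := ACh.
have /mxOverP dreal := hermitian_spectral_diag_real ACh.
exists [seq complex.Re (spectral_diag AC 0 i) | i <- enum 'I_n].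
apply: (map_poly_inj (real_complex R)).
rewrite map_char_poly -/AC [X in char_poly X]ACE char_poly_similar ?spectral_unit//.
rewrite char_poly_trig ?diag_mx_is_trig// rmorph_prod big_map big_enum/=.
apply: eq_bigr => i _; rewrite rmorphB/= map_polyX map_polyC/= RRe_real//.
by rewrite mxE eqxx mulr1n.
Qed.

Lemma real_eigenvaluesP (R : realType) (n : nat) (A : 'M[R]_n) :
  A^T = A -> char_poly A = \prod_(x <- real_eigenvalues A) ('X - x%:P).
Proof.
move=> /char_poly_sym_split[s sE].
have p0 : char_poly A != 0 by rewrite monic_neq0// char_poly_monic.
rewrite {1}sE; apply: perm_big; apply/allP => x _ /=; apply/eqP.
rewrite count_flatten -map_comp -mu_prod_XsubC -sE sumnE big_map/=.
have [rx|nrx] := boolP (x \in rootsR (char_poly A)).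
  rewrite (bigD1_seq x rx) ?uniq_roots//= count_nseq/= eqxx mul1n.
  by rewrite big1 ?addn0// => y /negPf yx; rewrite count_nseq/= yx.
rewrite mupNroot; last by rewrite -(roots_on_rootsR p0) in nrx.
apply/esym; rewrite big_seq big1// => y yr; rewrite count_nseq/=.
by case: eqP yr nrx => // -> ->.
Qed.

Lemma gram_eigenvalue_ge0 (R : realType) (n : nat) (X : 'M[R]_n) (a : R) :
  eigenvalue (X^T *m X) a -> 0 <= a.
Proof.
have sq (v : 'rV[R]_n) : (v *m v^T) 0 0 = \sum_i v 0 i ^+ 2.
  by rewrite mxE; apply: eq_bigr => i _; rewrite mxE expr2.
have sq_ge0 (v : 'rV[R]_n) : 0 <= (v *m v^T) 0 0.
  by rewrite sq sumr_ge0// => i _; rewrite sqr_ge0.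
move=> /eigenvalueP[v /(congr1 (mulmx^~ v^T)) va v0].
have vv : 0 < (v *m v^T) 0 0.
  rewrite lt_neqAle sq_ge0 andbT eq_sym; apply: contra_neq v0.
  rewrite sq => /eqP; rewrite psumr_eq0 => [/allP v0|i _]; last exact: sqr_ge0.
  apply/rowP => i; rewrite mxE; apply/eqP; rewrite -sqrf_eq0.
  by apply: v0; rewrite mem_index_enum.
rewrite -(pmulr_lge0 _ vv).
have := sq_ge0 (v *m X^T).
rewrite trmx_mul trmxK mulmxA -(mulmxA v) va -scalemxAl mxE.
by rewrite mulrC.
Qed.

Lemma singular_valuesP (R : realType) (n : nat) (X : 'M[R]_n) :
  char_poly (X^T *m X) = \prod_(s <- singular_values X) ('X - (s ^+ 2)%:P).
Proof.
have symX : (X^T *m X)^T = X^T *m X by rewrite trmx_mul trmxK.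
have p0 : char_poly (X^T *m X) != 0 by rewrite monic_neq0// char_poly_monic.
rewrite real_eigenvaluesP// (perm_big _ (permEl (perm_sort _ _)))/= big_map.
rewrite !big_seq; apply: eq_bigr => x /flattenP[_ /mapP[y yr ->]].
rewrite mem_nseq => /andP[_ /eqP->]; rewrite sqr_sqrtr//.
apply: (@gram_eigenvalue_ge0 _ _ X); rewrite eigenvalue_root_char.
by move: yr; rewrite -(roots_on_rootsR p0).
Qed.

Lemma size_singular_values (R : realType) (n : nat) (X : 'M[R]_n) :
  size (singular_values X) = n.
Proof.
apply: succn_inj; rewrite -(size_char_poly (X^T *m X)) singular_valuesP.
rewrite -(big_map (fun s => s ^+ 2) xpredT (fun y => 'X - y%:P)).
by rewrite size_prod_XsubC size_map.
Qed.

(* [singval X k] is sigma_k(X) for k >= 1, numbered from 1; it is 0 for k > n,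
   and the value at k = 0 is meaningless. *)
Definition singval (R : realType) (n : nat) (X : 'M[R]_n) (k : nat) : R :=
  nth 0 (singular_values X) k.-1.

(* The bound k <= n on the range loses nothing when eps >= 0, because then
   k = n satisfies the condition: sigma_{n+1}(X) = 0. *)
Definition eps_rank (R : realType) (n : nat) (eps : R) (X : 'M[R]_n) : nat :=
  [arg min_(k < (ord_max : 'I_n.+1)
            | (singval X k.+1 <= eps * singval X 1)%R) (k : nat)]%N.

Lemma eps_rankP (R : realType) (n : nat) (eps : R) (X : 'M[R]_n) :
    0 <= eps ->
  singval X (eps_rank eps X).+1 <= eps * singval X 1 /\
  forall k, singval X k.+1 <= eps * singval X 1 -> (eps_rank eps X <= k)%N.
Proof.
move=> eps_ge0; rewrite /eps_rank; case: arg_minnP => /= [|i ile imin].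
  rewrite {1}/singval nth_default ?size_singular_values//.
  rewrite mulr_ge0// /singval; have [?|?] := ltnP 0 (size (singular_values X)).
    suff /allP : all (>= 0) (singular_values X) by apply; rewrite mem_nth.
    by rewrite all_sort all_map; apply/allP => x _ /=; rewrite sqrtr_ge0.
  by rewrite nth_default.
split=> // k kle; have [kn|nk] := ltnP k n.+1; first exact: (imin (Ordinal kn)).
exact: leq_trans (ltnW (ltn_ord i)) nk.
Qed.

(* Main.v *)
Require Import Defs.
From HB Require Import structures.
From mathcomp Require Import all_boot all_order all_algebra.
From mathcomp Require Import spectral sesquilinear complex.
From mathcomp Require Import all_classical all_reals all_analysis.
From mathcomp Require Import ring lra zify.

(** Why the bounds hold.

    The matrix H is the Gram matrix of the form (p, q) -> L(p q), where L
    sends 'X^a to h_(a+2) ([moment]); extended to complex coefficients it is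
    the Hermitian form L(p p^ * ), p^ * being the polynomial with conjugate
    coefficients.  The squared Euclidean norm of the coefficient vector of p
    is, by [parseval], the mean of |p(z)|^2 over the N-th roots z of -1, as
    soon as p has degree < N.  Let D, M, E be polynomials with real
    coefficients and degree at most 2k such that

      D^2 = M^2 + E^2   and   |D(z)| <= s |M(z)| whenever z^N = -1.

    For every g of degree < N - 2k, the form decreases when D g is replaced by
    M g, because L((E g)(E g)^ * ) >= 0, whereas the norm of D g is at most s
    times that of M g.  If i - j is at least about 2k, a dimension count yields
    a g <> 0 such that D g has no component along the eigenvectors of
    eigenvalue > sigma_j and M g none along those of eigenvalue < sigma_i.  The
    two Rayleigh quotients then give sigma_i <= s^2 sigma_j ([singval_shift]).
    Taking N = 2 floor(n/2) treats even and odd n together.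

    It remains to find D and M with s small.  With P the product of the
    i('X + 1) - x_l('X - 1), take D = P P^ * and M = (P^2 + P^ *^2) / 2.  In the
    Cayley variable y = i(z + 1)/(z - 1), which is real on the unit circle,
    D / M is, up to sign, 2 r / (1 + r^2) with r(y) the product of the
    (y - x_l)/(y + x_l); at the roots of -1, |y| lies in [1/B, B] with
    B = 2 N / pi, so nodes x_l making r small on that interval are needed: this
    is Zolotarev's third problem for two symmetric intervals.

    The nodes are values of Phi_h(u), the sum of sech(u + j h) over all integers
    j ([dnsum], Jacobi's dn up to scaling), which satisfies
      Phi_h(u) = Phi_2h(u) + Phi_2h(u + h)  and
      Phi_2h(u) Phi_2h(u + h) is constant in u.
    Hence R_h(u, v) = (Phi_h(u) - Phi_h(v)) / (Phi_h(u) + Phi_h(v)) ([dnratio])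
    factors as R_2h(u, v) R_2h(u, v + h).  Doubling the period indefinitely,
    Phi degenerates to sech and R_h becomes a product of hyperbolic tangents, in
    which the factors coming from equally spaced nodes v recombine into the same
    kind of product for the finer spacing 2d.  So |r| is bounded by the square
    root of R_2d(0, d) ([nodeprod_le], [halfratio_ge]).

    The last ingredient is R_2d(0, d) <= 4 exp(- pi^2 / (2 d))
    ([halfratio_modular]), in substance Jacobi's imaginary transformation.  The
    doubling rules give R_4d(0, 2d)^2 <= 4 R_2d(0, d) (Landen), so that
    log(4 / R_2d(0, d)) at most doubles when d is halved; and it is at least
    pi^2 / (2 d) to leading order as d -> 0, by expanding the logarithm of the
    product of hyperbolic tangents and summing the inverse squares of the odd
    integers.  Iterating the halving turns this asymptotic estimate into an
    inequality for every d. *)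

Set Implicit Arguments.
Unset Strict Implicit.
Unset Printing Implicit Defensive.

Import Order.TTheory GRing.Theory Num.Theory.
Import numFieldNormedType.Exports.
Local Open Scope ring_scope.

(** * Hyperbolic functions *)

Section Hyperbolic.
Variable R : realType.
Implicit Types (x y u v h : R).

Definition sech x := 2 / (expR x + expR (- x)).
Definition tanhR x := (expR x - expR (- x)) / (expR x + expR (- x)).
Definition sinhR x := (expR x - expR (- x)) / 2.

Lemma expRDN_gt0 x : 0 < expR x + expR (- x).
Proof. by rewrite addr_gt0 ?expR_gt0. Qed.

Lemma sech_gt0 x : 0 < sech x.
Proof. by rewrite divr_gt0 ?expRDN_gt0. Qed.

Lemma sechN x : sech (- x) = sech x.
Proof. by rewrite /sech opprK addrC. Qed.

Lemma sech_ub x : sech x <= 2 * expR (- x).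
Proof.
rewrite /sech ler_pM2l// -[leRHS]invrK lef_pV2 ?posrE ?invr_gt0 ?expRDN_gt0 ?expR_gt0//.
by rewrite expRN invrK lerDl invr_ge0 expR_ge0.
Qed.

Lemma sech0 : sech 0 = 1.
Proof. by rewrite /sech oppr0 expR0; field. Qed.

Lemma tanhRN x : tanhR (- x) = - tanhR x.
Proof. by rewrite /tanhR opprK -mulNr opprB [X in _ / X]addrC. Qed.

Lemma tanhR_lt1 x : tanhR x < 1.
Proof.
rewrite /tanhR ltr_pdivrMr ?expRDN_gt0// mul1r.
by have := expR_gt0 (- x); lra.
Qed.

Lemma tanhR_gtN1 x : -1 < tanhR x.
Proof. by rewrite ltrNl -tanhRN tanhR_lt1. Qed.

Lemma norm_tanhR_le1 x : `|tanhR x| <= 1.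
Proof. by rewrite ler_norml !ltW ?tanhR_lt1 ?tanhR_gtN1. Qed.

Lemma tanhR_gt0 x : 0 < x -> 0 < tanhR x.
Proof.
move=> x0; rewrite divr_gt0 ?expRDN_gt0// subr_gt0 ltr_expR.
by rewrite (lt_trans _ x0)// oppr_lt0.
Qed.

Lemma sinhR_gt0 x : 0 < x -> 0 < sinhR x.
Proof.
move=> x0; rewrite divr_gt0// subr_gt0 ltr_expR.
by rewrite (lt_trans _ x0)// oppr_lt0.
Qed.

(** Partial fractions: a product of two translates of sech is a difference of
    values of tanh, which is what makes lattice sums of such products telescope. *)
Lemma sechM x d : sech x * sech (x + d) * sinhR d = tanhR (x + d) - tanhR x.
Proof.
rewrite /sech /tanhR /sinhR opprD !expRD !expRN.
have := expR_gt0 x; have := expR_gt0 d; move: (expR x) (expR d) => X D D0 X0.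
have ? : 0 < X * X by exact: mulr_gt0.
have ? : 0 < (X * D) * (X * D) by rewrite !mulr_gt0.
by field; rewrite !gt_eqF//; nra.
Qed.

Lemma tanhR_ge_exp x : 1 - 2 * expR (- (2 * x)) <= tanhR x.
Proof.
rewrite /tanhR ler_pdivlMr ?expRDN_gt0//.
have -> : - (2 * x) = - x + - x by ring.
rewrite expRD expRN; have := expR_gt0 x; move: (expR x) => X X0.
rewrite -subr_ge0; set d := (X in 0 <= X).
have -> : d = 2 * X^-1 ^+ 3 by rewrite /d; field; rewrite gt_eqF.
by rewrite mulr_ge0// exprn_ge0// invr_ge0 ltW.
Qed.

Lemma ler_tanhR x y : x <= y -> tanhR x <= tanhR y.
Proof.
move=> xy; rewrite -subr_ge0.
have -> : y = x + (y - x) by ring.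
rewrite -sechM mulr_ge0//; first by rewrite mulr_ge0// ltW// sech_gt0.
by rewrite divr_ge0// subr_ge0 ler_expR; lra.
Qed.

End Hyperbolic.

(** * The periodization of sech *)

Section Periodization.
Local Open Scope classical_set_scope.
Local Open Scope ring_scope.
Variable R : realType.
Implicit Types (x y u v h : R).

Lemma geo_sum_le (p : R) n : 0 <= p < 1 -> \sum_(j < n) p ^+ j <= (1 - p)^-1.
Proof.
move=> /andP[p0 p1]; have q0 : 0 < 1 - p by rewrite subr_gt0.
rewrite -(ler_pM2l q0) divff ?gt_eqF//.
have := subrX1 p n; have := exprn_ge0 n p0; nra.
Qed.

Definition sechpart n h u := \sum_(j < n) sech (u + j%:R * h).
Definition sechsum h u := limn (fun n => sechpart n h u).

(** The terms are dominated by a geometric series, uniformly in n. *)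
Lemma sechpart_ub n h u : 0 < h ->
  sechpart n h u <= 2 * expR (- u) / (1 - expR (- h)).
Proof.
move=> h0; rewrite /sechpart.
have p1 : 0 <= expR (- h) < 1 by rewrite expR_ge0 expR_lt1 oppr_lt0.
apply: (@le_trans _ _ (\sum_(j < n) 2 * expR (- u) * expR (- h) ^+ j)).
  apply: ler_sum => j _; apply: le_trans (sech_ub _) _.
  by rewrite opprD expRD -mulrN expRM_natl mulrA.
rewrite -mulr_sumr ler_wpM2l ?geo_sum_le//.
Qed.

Lemma sechpart_nd h u : nondecreasing_seq (fun n => sechpart n h u).
Proof.
apply/nondecreasing_seqP => n; rewrite /sechpart big_ord_recr/= lerDl.
exact/ltW/sech_gt0.
Qed.

Lemma sechsum_cvg h u : 0 < h -> (fun n => sechpart n h u) @ \oo --> sechsum h u.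
Proof.
move=> h0; apply: nondecreasing_is_cvgn; first exact: sechpart_nd.
exists (2 * expR (- u) / (1 - expR (- h))) => _ [n _ <-].
exact: sechpart_ub.
Qed.

Lemma sechpart_le n h u : 0 < h -> sechpart n h u <= sechsum h u.
Proof.
move=> h0; apply: nondecreasing_cvgn_le; first exact: sechpart_nd.
by apply/cvg_ex; exists (sechsum h u); exact: sechsum_cvg.
Qed.

Lemma sechsum_ub h u : 0 < h ->
  sechsum h u <= 2 * expR (- u) / (1 - expR (- h)).
Proof.
move=> h0; apply: limr_le; first by apply/cvg_ex; exists (sechsum h u); exact: sechsum_cvg.
by apply: nearW => n; exact: sechpart_ub.
Qed.

Lemma sechsum_ge0 h u : 0 < h -> 0 <= sechsum h u.
Proof. by move=> h0; have := sechpart_le 0 u h0; rewrite /sechpart big_ord0. Qed.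

Lemma sechsum_rec h u : 0 < h -> sechsum h u = sech u + sechsum h (u + h).
Proof.
move=> h0.
have c1 : (fun n => sechpart n.+1 h u) @ \oo --> sechsum h u.
  by have := @sechsum_cvg h u h0; rewrite -cvg_shiftS.
have c2 : (fun n => sechpart n.+1 h u) @ \oo --> sech u + sechsum h (u + h).
  rewrite (_ : (fun _ => _) = (fun n => sech u + sechpart n h (u + h))).
    by apply: cvgD; [exact: cvg_cst|exact: sechsum_cvg].
  apply/funext => n; rewrite /sechpart big_ord_recl/= mul0r addr0; congr (_ + _).
  by apply: eq_bigr => i _; rewrite /bump/= natrD mulrDl mul1r addrA.
exact: (cvg_unique _ c1 c2).
Qed.

Lemma sechsum_split h u : 0 < h ->
  sechsum h u = sechsum (2 * h) u + sechsum (2 * h) (u + h).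
Proof.
move=> h0; have h20 : 0 < 2 * h by rewrite mulr_gt0.
have c1 : (fun n => sechpart n.*2 h u) @ \oo --> sechsum h u.
  apply: (@cvg_comp _ _ _ double (fun n => sechpart n h u) _ \oo); last exact: sechsum_cvg.
  move=> P [N _ NP]; exists N => // n /= Nn; apply: NP => /=.
  by rewrite (leq_trans Nn)// -addnn leq_addr.
have c2 : (fun n => sechpart n.*2 h u) @ \oo -->
    sechsum (2 * h) u + sechsum (2 * h) (u + h).
  rewrite (_ : (fun _ => _) =
      (fun n => sechpart n (2 * h) u + sechpart n (2 * h) (u + h))).
    by apply: cvgD; exact: sechsum_cvg.
  apply/funext => n; rewrite /sechpart; elim: n => [|n IH].
    by rewrite !big_ord0 addr0.
  rewrite doubleS !big_ord_recr/= IH.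
  have -> : u + n%:R * (2 * h) = u + n.*2%:R * h.
    by rewrite -[n.*2]muln2 natrM; ring.
  have -> : u + h + n%:R * (2 * h) = u + n.*2.+1%:R * h.
    by rewrite -[n.*2.+1]addn1 natrD -[n.*2]muln2 natrM; ring.
  ring.
exact: (cvg_unique _ c1 c2).
Qed.

(** The sum of sech over the lattice u + h Z, which is Jacobi's dn up to scaling.
    As sech is even, the half of the lattice to the left of u is the half-lattice
    starting at h - u. *)
Definition dnsum h u := sechsum h u + sechsum h (h - u).

Lemma dnsum_ge_sech h u : 0 < h -> sech u <= dnsum h u.
Proof.
move=> h0; rewrite /dnsum sechsum_rec// -addrA lerDl.
by rewrite addr_ge0// sechsum_ge0.
Qed.

Lemma dnsum_gt0 h u : 0 < h -> 0 < dnsum h u.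
Proof. by move=> h0; apply: lt_le_trans (dnsum_ge_sech u h0); exact: sech_gt0. Qed.

Lemma dnsumDh h u : 0 < h -> dnsum h (u + h) = dnsum h u.
Proof.
move=> h0; rewrite /dnsum (sechsum_rec u)//.
have -> : h - (u + h) = - u by ring.
rewrite (sechsum_rec (- u))// sechN (addrC (- u)); ring.
Qed.

Lemma dnsumN h u : 0 < h -> dnsum h (- u) = dnsum h u.
Proof.
move=> h0; rewrite -(dnsumDh u)// /dnsum opprK addrC (addrC h u); congr (_ + _).
by congr sechsum; ring.
Qed.

(** The lattice of step h is the union of two translates of the lattice of step
    2 h. *)
Lemma dnsum_double h u : 0 < h ->
  dnsum h u = dnsum (2 * h) u + dnsum (2 * h) (u + h).
Proof.
move=> h0; rewrite /dnsum (sechsum_split u)// (sechsum_split (h - u))//.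
have -> : h - u + h = 2 * h - u by ring.
have -> : 2 * h - (u + h) = h - u by ring.
ring.
Qed.

Lemma dnsum_ub h u : 0 < h ->
  dnsum h u <= 2 * (expR (- u) + expR (u - h)) / (1 - expR (- h)).
Proof.
move=> h0; have := sechsum_ub u h0; have := sechsum_ub (h - u) h0.
by rewrite opprB /dnsum mulrDr mulrDl; lra.
Qed.

Lemma dnsum_subMn h u n : 0 < h -> dnsum h (u - n%:R * h) = dnsum h u.
Proof.
move=> h0; elim: n => [|n IH]; first by rewrite mul0r subr0.
rewrite -IH -(dnsumDh (u - n.+1%:R * h))//; congr dnsum.
by rewrite -[n.+1]addn1 natrD; ring.
Qed.

(** When the period tends to infinity only the lattice point u itself stays at
    bounded distance from the origin. *)
Lemma dnsum_cvg_sech h u : 0 < h ->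
  (fun n => dnsum ((2 ^ n)%:R * h) u) @ \oo --> sech u.
Proof.
move=> h0.
have H0 n : 0 < (2 ^ n)%:R * h by rewrite mulr_gt0// ltr0n expn_gt0.
have ph : 0 < 1 - expR (- h) by rewrite subr_gt0 expR_lt1 oppr_lt0.
pose C := 2 * (expR (- u) + expR u) / (1 - expR (- h)).
have C0 : 0 <= C by rewrite /C divr_ge0 ?(ltW ph)// mulr_ge0// addr_ge0// expR_ge0.
have Hn n : n%:R * h <= (2 ^ n)%:R * h.
  by rewrite ler_pM2r// ler_nat ltnW// ltn_expl.
have up n : dnsum ((2 ^ n)%:R * h) u <= sech u + C * expR (- h) ^+ n.
  rewrite /dnsum sechsum_rec// -addrA lerD2l.
  have H1 : h <= (2 ^ n)%:R * h by rewrite ler_peMl ?(ltW h0)// ler1n expn_gt0.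
  have := sechsum_ub (u + (2 ^ n)%:R * h) (H0 n).
  have := sechsum_ub ((2 ^ n)%:R * h - u) (H0 n).
  have Hp := H0 n; set H := _ * h in H1 Hp *.
  have D1 : (1 - expR (- H))^-1 <= (1 - expR (- h))^-1.
    rewrite lef_pV2 ?posrE ?subr_gt0 ?expR_lt1 ?oppr_lt0//.
    by rewrite lerD2l lerNl opprK ler_expR lerN2.
  have D2 : expR (- H) <= expR (- h) ^+ n.
    by rewrite -expRM_natl ler_expR mulrN lerN2 Hn.
  have D0 : 0 < (1 - expR (- H))^-1 by rewrite invr_gt0 subr_gt0 expR_lt1 oppr_lt0.
  rewrite opprB !opprD !expRD => A B; apply: le_trans (lerD B A) _.
  have -> : 2 * (expR (- u) * expR (- H)) / (1 - expR (- H)) +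
      2 * (expR u * expR (- H)) / (1 - expR (- H)) =
      2 * (expR (- u) + expR u) * expR (- H) * (1 - expR (- H))^-1 by ring.
  have -> : C * expR (- h) ^+ n =
      2 * (expR (- u) + expR u) * expR (- h) ^+ n * (1 - expR (- h))^-1.
    by rewrite /C; ring.
  have E0 : 0 <= 2 * (expR (- u) + expR u) by rewrite mulr_ge0// addr_ge0// expR_ge0.
  by apply: ler_pM => //; rewrite ?(ltW D0) ?mulr_ge0 ?expR_ge0// ler_wpM2l.
apply: (@squeeze_cvgr _ _ _ _ (fun=> sech u) (fun n => sech u + C * expR (- h) ^+ n)).
- by apply: nearW => n; rewrite dnsum_ge_sech// up.
- exact: cvg_cst.
- rewrite -[X in _ --> X]addr0; apply: cvgD; first exact: cvg_cst.
  rewrite -[X in _ --> X](mulr0 C); apply: cvgM; first exact: cvg_cst.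
  by apply: cvg_expr; rewrite ger0_norm ?expR_ge0// expR_lt1 oppr_lt0.
Qed.

End Periodization.

(** * The product of two half-period translates is constant *)

Section ProductLaw.
Local Open Scope classical_set_scope.
Local Open Scope ring_scope.
Variable R : realType.
Implicit Types (x y u v h : R).

Lemma sum_ord_recr_cond (P : pred nat) (F : nat -> R) n :
  \sum_(i < n.+1 | P i) F i = \sum_(i < n | P i) F i + (if P n then F n else 0).
Proof. by rewrite big_mkcond big_ord_recr/= -big_mkcond. Qed.

(** Pairs (even site, odd site) are grouped by their distance d, which is odd. *)
Lemma mul_sum_parity (s : nat -> R) n :
  (\sum_(i < n | ~~ odd i) s i) * (\sum_(i < n | odd i) s i) =
  \sum_(d < n | odd d) \sum_(i < n - d) s i * s (i + d)%N.
Proof.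
elim: n => [|n IH]; first by rewrite !big_ord0 mul0r.
transitivity (\sum_(d < n | odd d) \sum_(i < n - d) s i * s (i + d)%N +
    s n * \sum_(i < n.+1 | odd (n - i)) s i).
  rewrite -IH (sum_ord_recr_cond (fun i => ~~ odd i)) (sum_ord_recr_cond odd).
  rewrite (sum_ord_recr_cond (fun i => odd (n - i))) subnn/= addr0.
  have -> : \sum_(i < n | odd (n - i)) s i = \sum_(i < n | odd n (+) odd i) s i.
    by apply: eq_bigl => i; rewrite oddB ?(ltnW (ltn_ord i)).
  case: (odd n); rewrite /= addr0; first by rewrite mulrDr; congr (_ + _); rewrite mulrC.
  by rewrite mulrDl.
rewrite (sum_ord_recr_cond odd (fun d => \sum_(i < n.+1 - d) s i * s (i + d)%N)).
have -> : (if odd n then \sum_(i < n.+1 - n) s i * s (i + n)%N else 0) =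
          if odd n then s n * s 0%N else 0.
  by case: ifP => //; rewrite subSnn big_ord1 add0n mulrC.
have -> : \sum_(d < n | odd d) \sum_(i < n.+1 - d) s i * s (i + d)%N =
    \sum_(d < n | odd d) (\sum_(i < n - d) s i * s (i + d)%N + s n * s (n - d)%N).
  apply: eq_bigr => d _; rewrite subSn ?(ltnW (ltn_ord d))// big_ord_recr/=.
  by rewrite subnK ?(ltnW (ltn_ord d))// [s _ * _]mulrC.
rewrite big_split/= -addrA; congr (_ + _).
have -> : \sum_(i < n.+1 | odd (n - i)) s i = \sum_(i < n.+1 | odd i) s (n - i)%N.
  rewrite (reindex_inj rev_ord_inj)/=; apply: eq_big => [i|i _]; rewrite subSS//.
  by rewrite subKn// -ltnS.
by rewrite (sum_ord_recr_cond odd (fun i => s (n - i)%N)) subnn mulrDr mulr_sumr; case: ifP; rewrite ?mulr0.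
Qed.

Lemma sum_shift_telescope (t : nat -> R) m d :
  \sum_(i < m) (t (i + d)%N - t i) = \sum_(i < d) (t (m + i)%N - t i).
Proof.
have e1 : \sum_(i < m + d) t i = \sum_(i < m) t i + \sum_(i < d) t (m + i)%N.
  by rewrite big_split_ord.
have e2 : \sum_(i < m + d) t i = \sum_(i < d) t i + \sum_(i < m) t (i + d)%N.
  rewrite addnC big_split_ord/=; congr (_ + _).
  by apply: eq_bigr => i _; rewrite addnC.
by rewrite !sumrB; lra.
Qed.

Lemma sum_even_double (s : nat -> R) n :
  \sum_(i < n.*2 | ~~ odd i) s i = \sum_(a < n) s a.*2.
Proof.
elim: n => [|n IH]; first by rewrite !big_ord0.
rewrite doubleS 2!(sum_ord_recr_cond (fun i => ~~ odd i)) IH big_ord_recr/=.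
by rewrite odd_double/= addr0.
Qed.

Lemma sum_odd_double (s : nat -> R) n :
  \sum_(i < n.*2 | odd i) s i = \sum_(a < n) s a.*2.+1.
Proof.
elim: n => [|n IH]; first by rewrite !big_ord0.
by rewrite doubleS 2!(sum_ord_recr_cond odd) IH big_ord_recr/= odd_double addr0.
Qed.

Lemma natr_double n : n.*2%:R = 2 * n%:R :> R.
Proof. by rewrite -mul2n natrM. Qed.

(** A symmetric truncation of [dnsum]; the symmetry makes the two ends of the
    telescoping sums tend to 1 and -1. *)
Definition sechwin m h u := \sum_(a < m.*2) sech (u + (a%:R - m%:R) * h).

Lemma sechwinE m h u : sechwin m h u = sechpart m h u + sechpart m h (h - u).
Proof.
rewrite /sechwin -addnn big_split_ord/= addrC; congr (_ + _).
  by apply: eq_bigr => i _; rewrite natrD addrAC subrr add0r.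
rewrite (reindex_inj rev_ord_inj)/=; apply: eq_bigr => i _.
rewrite -sechN; congr sech; rewrite natrB// -[i.+1]addn1 natrD; ring.
Qed.

Lemma sechwin_cvg h u : 0 < h -> (fun m => sechwin m h u) @ \oo --> dnsum h u.
Proof.
move=> h0; under eq_fun do rewrite sechwinE.
by apply: cvgD; exact: sechsum_cvg.
Qed.

Lemma tanhR_cvg1 (c k : R) : 0 < k -> (fun m => tanhR (c + m%:R * k)) @ \oo --> (1 : R).
Proof.
move=> k0.
apply: (@squeeze_cvgr _ _ _ _ (fun m => 1 - 2 * expR (- (2 * c)) * expR (- (2 * k)) ^+ m) (fun=> 1)).
- apply: nearW => m; rewrite (ltW (tanhR_lt1 _)) andbT; apply: le_trans (tanhR_ge_exp _).
  by rewrite lerB// -mulrA -expRM_natl -expRD ler_wpM2l// ler_expR; lra.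
- rewrite -[X in _ --> X]subr0; apply: cvgB; first exact: cvg_cst.
  rewrite -[X in _ --> X](mulr0 (2 * expR (- (2 * c)))); apply: cvgM; first exact: cvg_cst.
  by apply: cvg_expr; rewrite ger0_norm ?expR_ge0// expR_lt1 oppr_lt0 mulr_gt0.
- exact: cvg_cst.
Qed.

Lemma tanhR_cvgN1 (c k : R) : 0 < k -> (fun m => tanhR (c - m%:R * k)) @ \oo --> (-1 : R).
Proof.
move=> k0; under eq_fun => m do rewrite -[_ - _]opprK tanhRN opprB addrC.
by apply: cvgN; exact: tanhR_cvg1.
Qed.

Section Window.
Variables (h u : R) (h0 : 0 < h) (m : nat).
Let y := u - (m.*2)%:R * h.
Let t i := tanhR (y + i%:R * h).

(** By [sechM] and the grouping by distance, the sum over all pairs at distance d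
    collapses to the d first and the d last values of tanh in the window. *)
Lemma sechwin_mul :
  sechwin m (2 * h) u * sechwin m (2 * h) (u + h) =
  \sum_(d < m.*2.*2 | odd d)
    (\sum_(i < d) (t (m.*2.*2 - d + i)%N - t i)) / sinhR (d%:R * h).
Proof.
pose s i := sech (y + i%:R * h).
have -> : sechwin m (2 * h) u = \sum_(i < m.*2.*2 | ~~ odd i) s i.
  rewrite sum_even_double; apply: eq_bigr => a _; rewrite /s /y; congr sech.
  by rewrite !natr_double; ring.
have -> : sechwin m (2 * h) (u + h) = \sum_(i < m.*2.*2 | odd i) s i.
  rewrite sum_odd_double; apply: eq_bigr => a _; rewrite /s /y; congr sech.
  by rewrite -[(val a).*2.+1]addn1 natrD !natr_double; ring.
rewrite mul_sum_parity; apply: eq_bigr => d od.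
have d0 : 0 < (d : nat)%:R * h by rewrite mulr_gt0// ltr0n odd_gt0.
rewrite -sum_shift_telescope mulr_suml; apply: eq_bigr => i _.
have -> : t (i + d)%N = tanhR (y + i%:R * h + d%:R * h).
  by rewrite /t natrD; congr tanhR; ring.
rewrite -sechM mulfK ?gt_eqF ?sinhR_gt0//; congr (_ * sech _).
by rewrite natrD; ring.
Qed.

(** Each difference of two values of tanh is at most 2, and this bound no longer
    depends on u; it is attained in the limit of large windows. *)
Lemma sechwin_mul_ub :
  sechwin m (2 * h) u * sechwin m (2 * h) (u + h) <=
  \sum_(d < m.*2.*2 | odd d) d.*2%:R / sinhR (d%:R * h).
Proof.
rewrite sechwin_mul; apply: ler_sum => d od.
have d0 : 0 < (d : nat)%:R * h by rewrite mulr_gt0// ltr0n odd_gt0.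
rewrite ler_pM2r ?invr_gt0 ?sinhR_gt0//.
apply: (@le_trans _ _ (\sum_(i < d) (2 : R))).
  apply: ler_sum => i _.
  by have := tanhR_lt1 (y + (m.*2.*2 - d + i)%N%:R * h); have := tanhR_gtN1 (y + i%:R * h);
    rewrite /t; lra.
by rewrite sumr_const card_ord natr_double mulr_natr.
Qed.

(** Discarding the distances d >= D leaves a fixed finite sum, whose limit is the
    D-th partial sum of the upper bound [sechwin_mul_ub]. *)
Lemma sechwin_mul_lb D : (D <= m.*2.*2)%N ->
  \sum_(d < D | odd d) (\sum_(i < d) (tanhR (u + (i%:R - d%:R) * h + m%:R * (2 * h)) -
       tanhR (u + i%:R * h - m%:R * (2 * h)))) / sinhR (d%:R * h) <=
  sechwin m (2 * h) u * sechwin m (2 * h) (u + h).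
Proof.
move=> Dm; rewrite sechwin_mul -(subnKC Dm) big_split_ord/=.
rewrite -[leLHS]addr0; apply: lerD; last first.
  apply: sumr_ge0 => d od; rewrite divr_ge0//; last first.
    by rewrite ltW// sinhR_gt0// mulr_gt0// ltr0n odd_gt0.
  apply: sumr_ge0 => i _; rewrite subr_ge0 ler_tanhR// lerD2l ler_pM2r// ler_nat.
  by rewrite leq_addl.
apply: ler_sum => d od; rewrite ler_pM2r ?invr_gt0; last first.
  by rewrite sinhR_gt0// mulr_gt0// ltr0n odd_gt0.
have dn : (d <= m.*2.*2)%N by rewrite (leq_trans _ Dm)// ltnW.
rewrite le_eqVlt; apply/orP; left; apply/eqP; apply: eq_bigr => i _.
rewrite /t /y subnKC// natrD natrB// !natr_double.
by congr (tanhR _ - tanhR _); ring.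
Qed.

End Window.

(** Every window product at u is at most a partial sum free of u, and each such
    partial sum is at most the limit of the window products at v. *)
Lemma dnsum_mul_shift_le h u v : 0 < h ->
  dnsum (2 * h) u * dnsum (2 * h) (u + h) <= dnsum (2 * h) v * dnsum (2 * h) (v + h).
Proof.
move=> h0; have h20 : 0 < 2 * h by rewrite mulr_gt0.
have W w : (fun m => sechwin m (2 * h) w * sechwin m (2 * h) (w + h)) @ \oo -->
    dnsum (2 * h) w * dnsum (2 * h) (w + h).
  by apply: cvgM; exact: sechwin_cvg.
apply: (@ler_cvg_to _ _ _ _ _ (fun=> dnsum (2 * h) v * dnsum (2 * h) (v + h)) _ _ (W u)).
  exact: cvg_cst.
apply: nearW => n; apply: le_trans (sechwin_mul_ub _ h0 _) _.
move: (n.*2.*2) => D.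
have C : (fun m => \sum_(d < D | odd d) (\sum_(i < d)
      (tanhR (v + (i%:R - d%:R) * h + m%:R * (2 * h)) -
       tanhR (v + i%:R * h - m%:R * (2 * h)))) / sinhR (d%:R * h)) @ \oo -->
    \sum_(d < D | odd d) d.*2%:R / sinhR (d%:R * h).
  apply: cvg_big => [|d od]; first exact: add_continuous.
  apply: cvgM; last exact: cvg_cst.
  have -> : d.*2%:R = \sum_(i < d) (1 - (-1)) :> R.
    by rewrite opprK sumr_const card_ord natr_double mulr_natr.
  apply: cvg_big => [|i _]; first exact: add_continuous.
  apply: cvgB; first exact: tanhR_cvg1.
  exact: tanhR_cvgN1.
apply: (ler_cvg_to C (W v)); exists D => // m /= Dm; apply: sechwin_mul_lb => //.
by rewrite (leq_trans Dm)// -addnn -addnn -addnA leq_addr.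
Qed.

Lemma dnsum_mul_shift h u v : 0 < h ->
  dnsum (2 * h) u * dnsum (2 * h) (u + h) = dnsum (2 * h) v * dnsum (2 * h) (v + h).
Proof. by move=> h0; apply/eqP; rewrite eq_le !dnsum_mul_shift_le. Qed.

End ProductLaw.

(** * Period doubling for the cross ratio *)

Section Ratio.
Local Open Scope classical_set_scope.
Local Open Scope ring_scope.
Variable R : realType.
Implicit Types (x y u v w h : R).

Lemma norm_cross_ratio_le1 x y : 0 < x -> 0 < y -> `|(x - y) / (x + y)| <= 1.
Proof.
move=> x0 y0; rewrite normrM normfV (gtr0_norm (addr_gt0 x0 y0)).
by rewrite ler_pdivrMr ?addr_gt0// mul1r ler_norml; apply/andP; split; lra.
Qed.

Definition dnratio h u v := (dnsum h u - dnsum h v) / (dnsum h u + dnsum h v).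
Definition sechratio u v := (sech u - sech v) / (sech u + sech v).

Lemma norm_dnratio_le1 h u v : 0 < h -> `|dnratio h u v| <= 1.
Proof. by move=> h0; apply: norm_cross_ratio_le1; exact: dnsum_gt0. Qed.

(** For a b = c d, the cross ratio of a + b and c + d is the product of the cross
    ratios of (a, c) and (a, d); here a b and c d are equal by [dnsum_mul_shift]. *)
Lemma dnratio_double h u v : 0 < h ->
  dnratio h u v = dnratio (2 * h) u v * dnratio (2 * h) u (v + h).
Proof.
move=> h0; have h20 : 0 < 2 * h by rewrite mulr_gt0.
rewrite /dnratio (dnsum_double u)// (dnsum_double v)//.
have := dnsum_mul_shift u v h0.
have := dnsum_gt0 u h20; have := dnsum_gt0 v h20.
have := dnsum_gt0 (u + h) h20; have := dnsum_gt0 (v + h) h20.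
move: (dnsum _ u) (dnsum _ (u + h)) (dnsum _ v) (dnsum _ (v + h)) => a b c d d0 b0 c0 a0 E.
have -> : b = c * d / a by rewrite -E mulrAC divff ?mul1r ?gt_eqF.
field; rewrite !gt_eqF// ?addr_gt0// ?mulr_gt0//; nra.
Qed.

Lemma dnratio_pow2 h u v n : 0 < h ->
  dnratio h u v = \prod_(i < 2 ^ n) dnratio ((2 ^ n)%:R * h) u (v + i%:R * h).
Proof.
move=> h0; elim: n => [|n IH]; first by rewrite expn0 big_ord1 mul1r mul0r addr0.
have H0 : 0 < (2 ^ n)%:R * h by rewrite mulr_gt0// ltr0n expn_gt0.
rewrite IH expnS mul2n -addnn big_split_ord/= -big_split/=; apply: eq_bigr => i _.
have e1 : (2 ^ n + 2 ^ n)%:R * h = 2 * ((2 ^ n)%:R * h) by rewrite natrD; ring.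
have e2 : v + (2 ^ n + i)%:R * h = v + i%:R * h + (2 ^ n)%:R * h by rewrite natrD; ring.
by rewrite e1 e2 -dnratio_double.
Qed.

Lemma dnratio_cvg h u v : 0 < h ->
  (fun n => dnratio ((2 ^ n)%:R * h) u v) @ \oo --> sechratio u v.
Proof.
move=> h0; apply: cvgM; first by apply: cvgB; exact: dnsum_cvg_sech.
apply: cvgV; first by rewrite gt_eqF// addr_gt0// sech_gt0.
by apply: cvgD; exact: dnsum_cvg_sech.
Qed.

Lemma prodr_norm01_le (F : nat -> R) m n j : (forall i, `|F i| <= 1) ->
  (j + m <= n)%N -> \prod_(i < n) `|F i| <= \prod_(i < m) `|F (j + i)%N|.
Proof.
move=> F1 jmn; rewrite -(subnKC jmn) !big_split_ord/=.
have P1 I (r : seq I) (G : I -> R) : (forall i, 0 <= G i <= 1) ->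
    0 <= \prod_(i <- r) G i <= 1.
  move=> G1; elim: r => [|i r IHr]; first by rewrite big_nil ler01 lexx.
  rewrite big_cons; have /andP[g0 g1] := G1 i; have /andP[p0 p1] := IHr.
  by rewrite mulr_ge0// mulr_ile1.
set a := \prod_(i < j) _; set b := \prod_(i < m) _; set c := \prod_(i < _) _.
have /andP[a0 a1] : 0 <= a <= 1 by apply: P1 => i; rewrite normr_ge0 F1.
have /andP[c0 c1] : 0 <= c <= 1 by apply: P1 => i; rewrite normr_ge0 F1.
have b0 : 0 <= b by apply: prodr_ge0 => i _; exact: normr_ge0.
by rewrite -[leRHS]mulr1 ler_pM ?mulr_ge0// -[leRHS]mul1r ler_wpM2r.
Qed.

(** In the factorization over the period 2^n h all factors have modulus at most 1.
    The first J of them converge to the factors on the right, and the others can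
    be dropped. *)
Lemma norm_dnratio_le h u v J : 0 < h ->
  `|dnratio h u v| <= \prod_(i < J) `|sechratio u (v + i%:R * h)|.
Proof.
move=> h0.
have C : (fun n => \prod_(i < J) `|dnratio ((2 ^ n)%:R * h) u (v + i%:R * h)|) @ \oo -->
    \prod_(i < J) `|sechratio u (v + i%:R * h)|.
  apply: cvg_big => [|i _]; first exact: mul_continuous.
  by apply: cvg_norm; exact: dnratio_cvg.
apply: (ler_cvg_to (cvg_cst _) C); exists J => // n /= Jn.
rewrite (dnratio_pow2 u v n h0) normr_prod.
apply: (@prodr_norm01_le (fun i => dnratio ((2 ^ n)%:R * h) u (v + i%:R * h)) J _ 0).
  by move=> i; rewrite norm_dnratio_le1// mulr_gt0// ltr0n expn_gt0.
by rewrite add0n (leq_trans Jn)// ltnW// ltn_expl.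
Qed.

Lemma sechratioE u v : sechratio u v = tanhR ((v - u) / 2) * tanhR ((v + u) / 2).
Proof.
pose a := v / 2; pose b := u / 2.
have -> : v = a + a by rewrite /a; field.
have -> : u = b + b by rewrite /b; field.
have -> : (a + a - (b + b)) / 2 = a - b by field.
have -> : (a + a + (b + b)) / 2 = a + b by field.
rewrite /sechratio /sech /tanhR !opprD !expRD !opprK !expRN.
have := expR_gt0 a; have := expR_gt0 b; move: (expR a) (expR b) => A B B0 A0.
have ? : 0 < A * A by exact: mulr_gt0.
have ? : 0 < B * B by exact: mulr_gt0.
have ? : 0 < (A * B) * (A * B) by rewrite !mulr_gt0.
have ? : 0 < A * A * (A * A) by rewrite !mulr_gt0.
have ? : 0 < B * B * (B * B) by rewrite !mulr_gt0.
field; rewrite !gt_eqF//; nra.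
Qed.

End Ratio.

(** * Equally spaced nodes *)

Section Nodes.
Variable R : realType.
Implicit Types (x y u v w h d a s : R).

Definition tanhprod n d := \prod_(i < n) tanhR (i.*2.+1%:R * d / 2).

Lemma tanhprod_gt0 n d : 0 < d -> 0 < tanhprod n d.
Proof. by move=> d0; apply: prodr_gt0 => i _; rewrite tanhR_gt0// divr_gt0// mulr_gt0. Qed.

Lemma ler_sech_abs x y : `|x| <= y -> sech y <= sech x.
Proof.
wlog x0 : x / 0 <= x.
  move=> W; have [x0|x0] := leP 0 x; first exact: W.
  by rewrite -normrN -(sechN x); apply: W; rewrite oppr_ge0 ltW.
rewrite (ger0_norm x0) => xy; rewrite /sech ler_pM2l// lef_pV2 ?posrE ?expRDN_gt0//.
rewrite -subr_ge0 !expRN.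
have := expR_gt0 x; have : 1 <= expR x by rewrite -expR0 ler_expR.
have : expR x <= expR y by rewrite ler_expR.
move: (expR x) (expR y) => X Y XY X1 X0; have Y0 : 0 < Y by exact: lt_le_trans XY.
have -> : Y + Y^-1 - (X + X^-1) = (Y - X) * (X * Y - 1) / (X * Y).
  by field; rewrite !gt_eqF.
by rewrite divr_ge0// mulr_ge0//; nra.
Qed.

(** The left-hand side is (sech w - sech a) / (sech w + sech a), which increases
    with sech w and is therefore largest at w = 0. *)
Lemma tanhR_pair_le a w : `|w| <= a ->
  `|tanhR ((a + w) / 2)| * `|tanhR ((- a + w) / 2)| <= tanhR (a / 2) ^+ 2.
Proof.
move=> wa.
have -> : (- a + w) / 2 = - ((a - w) / 2) by field.
rewrite tanhRN normrN -normrM mulrC -sechratioE expr2.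
have := sechratioE 0 a; rewrite subr0 addr0 => <-.
have := ler_sech_abs wa; have := sech_gt0 a.
have : sech w <= sech 0.
  suff -> : sech w = sech `|w| by rewrite ler_sech_abs// normr0.
  by case: (leP 0 w) => w0; [rewrite ger0_norm|rewrite ltr0_norm// sechN].
rewrite /sechratio sech0; move: (sech w) (sech a) => W A W1 A0 AW.
rewrite ger0_norm; last by rewrite divr_ge0//; lra.
rewrite ler_pdivrMr; last lra.
rewrite -subr_ge0; have -> : (1 - A) / (1 + A) * (W + A) - (W - A) = 2 * A * (1 - W) / (1 + A).
  by field; rewrite gt_eqF//; lra.
by rewrite divr_ge0 ?mulr_ge0//; lra.
Qed.

(** Among all positions of the origin relative to a lattice of step 2 d, the
    midpoint of two lattice points gives the largest product; the points are
    matched in pairs symmetric about that midpoint. *)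
Lemma tanhprod_window d w n : 0 < d -> `|w| <= d ->
  \prod_(j < n + n) `|tanhR ((j.*2.+1%:R * d - n.*2%:R * d + w) / 2)| <= tanhprod n d ^+ 2.
Proof.
move=> d0 wd; rewrite big_split_ord/= /tanhprod -prodrXl mulrC.
rewrite [X in _ * X](reindex_inj rev_ord_inj)/= -big_split/=.
apply: ler_prod => i _; rewrite mulr_ge0//=.
have -> : (n + i).*2.+1%:R * d - n.*2%:R * d + w = i.*2.+1%:R * d + w.
  by rewrite doubleD -addnS natrD; ring.
have -> : (n - i.+1).*2.+1%:R * d - n.*2%:R * d + w = - (i.*2.+1%:R * d) + w.
  have e : ((n - i.+1).*2.+1 + i.*2.+1 = n.*2)%N by have := ltn_ord i; lia.
  by rewrite -[n.*2 in LHS]e natrD; ring.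
apply: tanhR_pair_le; apply: le_trans wd _.
by rewrite ler_peMl ?ler1n// ltW.
Qed.

(** Nodes indexed by l in a period and copies of the period indexed by i together
    form one arithmetic progression. *)
Lemma big_ord_mul (F : nat -> R) n J :
  \prod_(l < n) \prod_(i < J) F (l + n * i)%N = \prod_(j < n * J) F j.
Proof.
elim: J => [|J IH].
  by rewrite muln0 big_ord0 big1// => i _; rewrite big_ord0.
rewrite mulnS addnC big_split_ord/= -IH -big_split/=.
by apply: eq_bigr => l _; rewrite big_ord_recr/= addnC.
Qed.

Lemma prod_period_shift (G : R -> R) s n a e :
  (forall v, G (v + n%:R * s) = G v) ->
  \prod_(l < n) G (a + l%:R * s) = \prod_(l < n) G (a - e%:R * s + l%:R * s).
Proof.
move=> Gn; elim: e => [|e ->]; first by rewrite mul0r subr0.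
case: n Gn => [|n] Gn; first by rewrite !big_ord0.
rewrite big_ord_recr [RHS]big_ord_recl/= mulrC; congr (_ * _).
  rewrite -[RHS]Gn; congr G; rewrite -[e.+1]addn1 -[n.+1]addn1 !natrD; ring.
apply: eq_bigr => i _; congr G.
by rewrite /bump/= natrD -[e.+1]addn1 natrD; ring.
Qed.

(** The value at Phi(u) of the modulus of the rational function with zeros Phi(v_l)
    and poles - Phi(v_l), for the v_l the odd multiples of d in half a period 4 k d. *)
Definition nodeprod k d u := \prod_(l < k) `|dnratio (k%:R * (4 * d)) u (l.*2.+1%:R * d)|.

(** By parity and periodicity the second half of the period repeats the nodes of
    the first half in reverse order, and a full period is invariant under shifts
    by 2 d. *)
Lemma nodeprod_sqr k d u :  0 < d -> (0 < k)%N ->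
  nodeprod k d u ^+ 2 =
  \prod_(l < k.*2) `|dnratio (k%:R * (4 * d)) u (d + l%:R * (2 * d))|.
Proof.
move=> d0 k0; have h0 : 0 < k%:R * (4 * d) by rewrite !mulr_gt0// ltr0n.
rewrite -addnn big_split_ord/= expr2; congr (_ * _).
  apply: eq_bigr => l _; congr (`|dnratio _ _ _|).
  by rewrite -[l.*2.+1]addn1 natrD natr_double; ring.
rewrite /nodeprod (reindex_inj rev_ord_inj)/=; apply: eq_bigr => l _.
rewrite /dnratio; suff -> : dnsum (k%:R * (4 * d)) ((k - l.+1).*2.+1%:R * d) =
  dnsum (k%:R * (4 * d)) (d + (k + l)%:R * (2 * d)) by [].
rewrite -dnsumN// -dnsumDh//; congr dnsum.
by rewrite -[(k - l.+1).*2.+1]addn1 natrD natr_double natrB// natrD -[l.+1]addn1 natrD; ring.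
Qed.

(** After period doubling the nodes form a lattice of step 2 d seen once from u and
    once from - u.  The window below starts far enough to the left to contain the
    2 n lattice points nearest to each of u and - u; w is the displacement of u
    from the nearest even multiple of d. *)
Lemma nodeprod_le k d u n : 0 < d -> (0 < k)%N -> 0 <= u ->
  nodeprod k d u <= tanhprod n d ^+ 2.
Proof.
move=> d0 k0 u0; have h0 : 0 < k%:R * (4 * d) by rewrite !mulr_gt0// ltr0n.
have X0 : 0 <= nodeprod k d u by apply: prodr_ge0 => i _.
have T0 := ltW (tanhprod_gt0 n d0).
rewrite -ler_sqr ?nnegrE ?exprn_ge0// nodeprod_sqr//.
have D0 : 0 < 2 * d by rewrite mulr_gt0.
pose e := Num.truncn ((u + d) / (2 * d)).
pose w := u - e.*2%:R * d.
have wd : `|w| <= d.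
  have /truncn_itv/andP[] : 0 <= (u + d) / (2 * d) by rewrite divr_ge0 ?(ltW D0)// addr_ge0// ltW.
  rewrite -/e ler_pdivlMr// ltr_pdivrMr// -[e.+1]addn1 natrD.
  by rewrite /w natr_double ler_norml => A B; apply/andP; split; lra.
rewrite (@prod_period_shift (fun v => `|dnratio (k%:R * (4 * d)) u v|) (2 * d) _ _ (e + n)); last first.
  move=> v; rewrite /dnratio natr_double.
  have -> : 2 * k%:R * (2 * d) = k%:R * (4 * d) by ring.
  by rewrite dnsumDh.
pose v j := d - (e + n)%:R * (2 * d) + j%:R * (2 * d).
apply: (@le_trans _ _ (\prod_(l < k.*2) \prod_(i < e + n) `|sechratio u (v (l + k.*2 * i)%N)|)).
  apply: ler_prod => l _; rewrite normr_ge0/=.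
  apply: le_trans (norm_dnratio_le _ _ (e + n) h0) _; rewrite le_eqVlt; apply/orP; left.
  apply/eqP; apply: eq_bigr => i _; congr (`|sechratio _ _|).
  by rewrite /v (natrD _ l) (natrM _ k.*2) natr_double; ring.
rewrite (big_ord_mul (fun j => `|sechratio u (v j)|)).
under eq_bigr do rewrite sechratioE normrM.
rewrite big_split/= [leRHS]expr2 mulrC.
have ken : (e.*2 + (n + n) <= k.*2 * (e + n))%N by nia.
apply: ler_pM; try by apply: prodr_ge0 => i _.
  apply: le_trans (@prodr_norm01_le _ (fun j => tanhR ((v j + u) / 2)) (n + n) _ 0 _ _) _.
  - by move=> i; exact: norm_tanhR_le1.
  - by apply: leq_trans ken; rewrite leq_addl.
  apply: le_trans (tanhprod_window _ d0 wd); rewrite le_eqVlt; apply/orP; left.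
  apply/eqP; apply: eq_bigr => i _; rewrite add0n /v /w; congr (`|tanhR (_ / 2)|).
  by rewrite natrD -[i.*2.+1]addn1 natrD !natr_double; ring.
apply: le_trans (@prodr_norm01_le _ (fun j => tanhR ((v j - u) / 2)) (n + n) _ e.*2 _ _) _ => //.
  by move=> i; exact: norm_tanhR_le1.
apply: (@le_trans _ _ _ _ _ _ (@tanhprod_window d (- w) n d0 _)); last by rewrite normrN.
rewrite le_eqVlt; apply/orP; left.
apply/eqP; apply: eq_bigr => i _; rewrite /v /w; congr (`|tanhR (_ / 2)|).
by rewrite !natrD -[i.*2.+1]addn1 natrD !natr_double; ring.
Qed.

End Nodes.

(** * The cross ratio at half a period *)

Section HalfRatio.
Local Open Scope classical_set_scope.
Local Open Scope ring_scope.
Variable R : realType.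
Implicit Types (x y u v w h d a s : R).

Lemma prod_norm_ge (f e : nat -> R) n : (forall i, `|f i| <= 1) ->
  (forall i, (i < n)%N -> 1 - e i <= `|f i|) -> (forall i, 0 <= e i) ->
  1 - \sum_(i < n) e i <= \prod_(i < n) `|f i|.
Proof.
move=> f1; elim: n => [|n IH] fe e0; first by rewrite !big_ord0 subr0.
rewrite !big_ord_recr/=.
have := IH (fun i lti => fe i (ltnW lti)) e0; have := fe n (leqnn _); have := e0 n.
have : 0 <= \prod_(i < n) `|f i| by apply: prodr_ge0 => i _.
have : \prod_(i < n) `|f i| <= 1.
  by apply: prodr_ile1 => i; rewrite normr_ge0 f1.
move: (\prod_(i < n) _) (\sum_(i < n) _) (`|f n|) (e n) => P S F E; nra.
Qed.

(** The factors of the half-period cross ratio [dnratio (2 * d) 0 d] after n + 1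
    doublings; those with v > 0 are kept, the others are their mirror images. *)
Definition halffactor n d i := dnratio ((2 ^ n.+1)%:R * (2 * d)) 0 (i.*2.+1%:R * d).

Lemma halffactor_le1 n d i : 0 < d -> `|halffactor n d i| <= 1.
Proof. by move=> d0; rewrite norm_dnratio_le1// !mulr_gt0// ltr0n expn_gt0. Qed.

Lemma halfratio_sqr d n : 0 < d ->
  dnratio (2 * d) 0 d = (\prod_(i < 2 ^ n) halffactor n d i) ^+ 2.
Proof.
move=> d0; have D0 : 0 < 2 * d by rewrite mulr_gt0.
have -> : dnratio (2 * d) 0 d = dnratio (2 * d) 0 (d - (2 ^ n)%:R * (2 * d)).
  by rewrite /dnratio dnsum_subMn.
rewrite (dnratio_pow2 _ _ n.+1)// expr2.
pose F i := dnratio ((2 ^ n.+1)%:R * (2 * d)) 0 (d - (2 ^ n)%:R * (2 * d) + i%:R * (2 * d)).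
have -> : \prod_(i < 2 ^ n.+1) F i = \prod_(i < 2 ^ n + 2 ^ n) F i.
  by rewrite addnn -mul2n -expnS.
rewrite big_split_ord/= /F.
congr (_ * _).
  rewrite (reindex_inj rev_ord_inj)/=; apply: eq_bigr => i _.
  rewrite /halffactor /dnratio -[dnsum _ (i.*2.+1%:R * d)]dnsumN ?mulr_gt0 ?ltr0n ?expn_gt0//.
  have -> // : d - (2 ^ n)%:R * (2 * d) + (2 ^ n - i.+1)%:R * (2 * d) = - (i.*2.+1%:R * d).
  by rewrite natrB// -[i.*2.+1]addn1 -[i.+1]addn1 !natrD natr_double; ring.
apply: eq_bigr => i _; rewrite /halffactor; congr dnratio.
by rewrite -[i.*2.+1]addn1 !natrD natr_double; ring.
Qed.

Lemma halffactor_cvg d i : 0 < d ->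
  (fun n => halffactor n d i) @ \oo --> tanhR (i.*2.+1%:R * d / 2) ^+ 2.
Proof.
move=> d0; have D0 : 0 < 2 * d by rewrite mulr_gt0.
have := @dnratio_cvg _ (2 * d) 0 (i.*2.+1%:R * d) D0.
by rewrite -cvg_shiftS sechratioE subr0 addr0 expr2.
Qed.

Lemma prod_halffactor_cvg d k : 0 < d ->
  (fun n => \prod_(i < k) `|halffactor n d i|) @ \oo --> tanhprod k d ^+ 2.
Proof.
move=> d0; rewrite /tanhprod -prodrXl; apply: cvg_big => [|i _]; first exact: mul_continuous.
rewrite -[X in _ --> X]ger0_norm ?sqr_ge0//.
by apply: cvg_norm; exact: halffactor_cvg.
Qed.

Lemma halfratio_le d k : 0 < d -> dnratio (2 * d) 0 d <= tanhprod k d ^+ 4.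
Proof.
move=> d0; have C := @prod_halffactor_cvg d k d0.
have C2 : (fun n => (\prod_(i < k) `|halffactor n d i|) ^+ 2) @ \oo --> tanhprod k d ^+ 4.
  by rewrite [X in _ --> X](exprM _ 2 2); apply: cvgM.
apply: (ler_cvg_to (cvg_cst _) C2); exists k => // n /= kn.
rewrite (halfratio_sqr n d0) -[leLHS]real_normK ?num_real//.
have F1 : \prod_(i < 2 ^ n) `|halffactor n d i| <= \prod_(i < k) `|halffactor n d i|.
  apply: (@prodr_norm01_le _ (halffactor n d) k (2 ^ n) 0); first by move=> i; exact: halffactor_le1.
  by rewrite add0n (leq_trans kn)// ltnW// ltn_expl.
by rewrite !normr_prod lerXn2r ?nnegrE ?prodr_ge0.
Qed.

(** For 0 <= v <= H / 2 the points of v + H Z are at distance at least v from the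
    origin, so that the sum at v is at most a multiple of exp(- v), whereas the sum
    at 0 is at least 1.  The multiple does not depend on H. *)
Lemma dnratio0_ge H v d : 0 < d -> 2 * d <= H -> 0 <= v -> 2 * v <= H ->
  1 - 8 / (1 - expR (- (2 * d))) * expR (- v) <= `|dnratio H 0 v|.
Proof.
move=> d0 dH v0 vH; have H0 : 0 < H by lra.
apply: le_trans (ler_norm _).
have := dnsum_ge_sech 0 H0; rewrite sech0 => P1.
have Pv := dnsum_gt0 v H0.
have up : dnsum H v <= 4 * expR (- v) / (1 - expR (- (2 * d))).
  apply: le_trans (dnsum_ub v H0) _.
  apply: ler_pM; rewrite ?invr_ge0 ?subr_ge0 ?expR_le1 ?mulr_ge0 ?addr_ge0 ?expR_ge0//.
  - by rewrite oppr_le0 ltW.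
  - suff : expR (v - H) <= expR (- v) by lra.
    by rewrite ler_expR; lra.
  - rewrite lef_pV2 ?posrE ?subr_gt0 ?expR_lt1 ?oppr_lt0 ?mulr_gt0//.
    by rewrite lerD2l lerN2 ler_expR lerN2.
apply: (@le_trans _ _ (1 - 2 * dnsum H v)).
  rewrite lerD2l lerN2; apply: le_trans (ler_wpM2l _ up) _ => //.
  by rewrite le_eqVlt; apply/orP; left; apply/eqP; ring.
rewrite /dnratio; move: (dnsum H 0) (dnsum H v) P1 Pv {up} => P V P1 V0.
have s0 : 0 < P + V by lra.
by rewrite ler_pdivlMr//; nra.
Qed.

(** Converse of [halfratio_le]: the factors of index >= k multiply to at least
    1 - C p^k uniformly in the number of doublings, so nothing is lost by keeping
    only the first k of them. *)
Lemma halfratio_ge d x : 0 < d -> 0 <= x -> (forall k, x <= tanhprod k d ^+ 2) ->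
  x ^+ 2 <= dnratio (2 * d) 0 d.
Proof.
move=> d0 x0 xT; have D0 : 0 < 2 * d by rewrite mulr_gt0.
set A := dnratio _ _ _.
have A0 : 0 <= A by rewrite /A (halfratio_sqr 0 d0) sqr_ge0.
rewrite -(sqr_sqrtr A0) lerXn2r ?nnegrE ?sqrtr_ge0//.
pose p := expR (- (2 * d)).
have p01 : 0 <= p < 1 by rewrite expR_ge0 expR_lt1 oppr_lt0.
pose C := 8 / (1 - p) / (1 - p).
have q0 : 0 < 1 - p by have /andP[_] := p01; rewrite -subr_gt0.
have C0 : 0 <= C by rewrite /C !divr_ge0// ltW.
have key k : x * (1 - C * p ^+ k) <= Num.sqrt A.
  have [e1|e1] := leP 0 (1 - C * p ^+ k); last first.
    by apply: le_trans (sqrtr_ge0 _); rewrite mulr_ge0_le0// ltW.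
  apply: le_trans (ler_wpM2r e1 (xT k)) _.
  have C1 : (fun n => (\prod_(i < k) `|halffactor n d i|) * (1 - C * p ^+ k)) @ \oo -->
      tanhprod k d ^+ 2 * (1 - C * p ^+ k).
    by apply: cvgM; [exact: prod_halffactor_cvg|exact: cvg_cst].
  apply: (ler_cvg_to C1 (cvg_cst _)).
  exists k => // n /= kn; have kn2 : (k <= 2 ^ n)%N by rewrite (leq_trans kn)// ltnW// ltn_expl.
  rewrite /A (halfratio_sqr n d0) sqrtr_sqr normr_prod.
  rewrite -(subnKC kn2) big_split_ord/= ler_wpM2l ?prodr_ge0//.
  have P0 : 0 <= 8 / (1 - p) by rewrite divr_ge0// ltW.
  apply: le_trans (@prod_norm_ge (fun i => halffactor n d (k + i)%N)
      (fun i => 8 / (1 - p) * p ^+ (k + i)%N) _ _ _ _).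
  - rewrite lerD2l lerN2 -mulr_sumr /C -[leRHS]mulrA ler_wpM2l//.
    under eq_bigr do rewrite exprD.
    rewrite -mulr_sumr mulrC ler_wpM2r ?geo_sum_le// exprn_ge0//.
    by have /andP[] := p01.
  - by move=> i; exact: halffactor_le1.
  - move=> i ik; have lt : (k + i < 2 ^ n)%N by rewrite -ltn_subRL.
    apply: le_trans (dnratio0_ge d0 _ _ _).
    + rewrite lerD2l lerN2 ler_wpM2l// /p -expRM_natl ler_expR.
      by rewrite mulrN lerN2 -[(k + i).*2.+1%:R]natr1 natr_double; nra.
    + by rewrite ler_peMl ?ler1n ?expn_gt0// ltW.
    + by rewrite mulr_ge0// ltW.
    + have : (k + i).*2.+1%:R <= (2 ^ n.+1)%:R :> R.
        by rewrite ler_nat expnS mul2n ltn_double.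
      by rewrite mulrCA ler_pM2r.
  - by move=> i; rewrite mulr_ge0// exprn_ge0//; have /andP[] := p01.
have Ck : (fun k => x * (1 - C * p ^+ k)) @ \oo --> x.
  rewrite -[X in _ --> X]mulr1; apply: cvgM; first exact: cvg_cst.
  rewrite -[X in _ --> X]subr0; apply: cvgB; first exact: cvg_cst.
  rewrite -[X in _ --> X](mulr0 C); apply: cvgM; first exact: cvg_cst.
  by apply: cvg_expr; rewrite ger0_norm ?expR_ge0// expR_lt1 oppr_lt0.
by apply: (ler_cvg_to Ck (cvg_cst _)); apply: nearW.
Qed.

(** Let X and Y be the values at 0 and at half a period for the period 4 d, and g
    the value at a quarter of it, so that g^2 = X Y.  The two cross ratios are
    (X - Y) / (X + Y) and (X + Y - 2 g) / (X + Y + 2 g): Landen's transformation. *)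
Lemma halfratio_landen d : 0 < d ->
  dnratio (2 * (2 * d)) 0 (2 * d) ^+ 2 <= 4 * dnratio (2 * d) 0 d.
Proof.
move=> d0; have D0 : 0 < 2 * d by rewrite mulr_gt0.
have D20 : 0 < 2 * (2 * d) by rewrite mulr_gt0.
rewrite {2}/dnratio (dnsum_double 0)// (dnsum_double d)// add0r.
have -> : dnsum (2 * (2 * d)) (d + 2 * d) = dnsum (2 * (2 * d)) d.
  by rewrite -dnsumN// -dnsumDh//; congr dnsum; ring.
have : dnsum (2 * (2 * d)) d * dnsum (2 * (2 * d)) (d + 2 * d) =
       dnsum (2 * (2 * d)) 0 * dnsum (2 * (2 * d)) (0 + 2 * d) by exact: dnsum_mul_shift.
have -> : dnsum (2 * (2 * d)) (d + 2 * d) = dnsum (2 * (2 * d)) d.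
  by rewrite -dnsumN// -dnsumDh//; congr dnsum; ring.
rewrite add0r /dnratio; have := dnsum_gt0 0 D20; have := dnsum_gt0 (2 * d) D20.
have := dnsum_gt0 d D20.
move: (dnsum _ 0) (dnsum _ (2 * d)) (dnsum _ d) => X Y g g0 Y0 X0 E.
have s0 : 0 < X + Y by lra.
have sg : 2 * g <= X + Y.
  rewrite -ler_sqr ?nnegrE; try lra.
  rewrite -subr_ge0; have -> : (X + Y) ^+ 2 - (2 * g) ^+ 2 = (X - Y) ^+ 2 + 4 * (X * Y - g * g) by ring.
  by rewrite E subrr mulr0 addr0 sqr_ge0.
have -> : ((X - Y) / (X + Y)) ^+ 2 = (X + Y - 2 * g) * (X + Y + 2 * g) / (X + Y) ^+ 2.
  have -> : (X + Y - 2 * g) * (X + Y + 2 * g) = (X - Y) ^+ 2 + 4 * (X * Y - g * g) by ring.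
  rewrite E subrr mulr0 addr0.
  by rewrite expr_div_n.
have -> : X + Y - (g + g) = X + Y - 2 * g by ring.
have -> : X + Y + (g + g) = X + Y + 2 * g by ring.
move: (X + Y) s0 sg => s s0 sg; have t0 : 0 < s + 2 * g by lra.
rewrite -subr_ge0.
have -> : 4 * ((s - 2 * g) / (s + 2 * g)) - (s - 2 * g) * (s + 2 * g) / s ^+ 2 =
  (s - 2 * g) * (s - 2 * g) * (3 * s + 2 * g) / (s ^+ 2 * (s + 2 * g)).
  by field; rewrite !gt_eqF.
by rewrite divr_ge0 ?mulr_ge0 ?exprn_ge0 ?subr_ge0//; lra.
Qed.

End HalfRatio.

(** * Calculus inequalities *)

Section Modular.
Variable R : realType.
Implicit Types (x y u v w h d a s z : R).

Lemma nondecreasing_by_derivative (f f' : R -> R) a b : a <= b ->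
  (forall x, a <= x <= b -> is_derive x 1 f (f' x)) ->
  (forall x, a < x < b -> 0 <= f' x) -> f a <= f b.
Proof.
move=> ab df f'0.
apply: (@ger0_derive1_ndecr _ f a b) => // [x|x|].
- rewrite in_itv/= => /andP[ax xb]; have [] // := df x.
  by rewrite !ltW.
- rewrite in_itv/= => /andP[ax xb]; rewrite derive1E.
  have [|_ ->] := df x; first by rewrite !ltW.
  by rewrite f'0// ax.
- apply: derivable_within_continuous => x; rewrite in_itv/= => xab.
  by have [] := df x xab.
Qed.

Lemma mulr_cos_le_sin x : 0 <= x <= pi -> x * cos x <= sin x.
Proof.
move=> /andP[x0 xpi].
pose f : R -> R := sin - id * cos.
have : f 0 <= f x.
  apply: (@nondecreasing_by_derivative f (fun y => y * sin y)) => // y.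
    move=> _; apply: is_derive_eq.
    by rewrite /GRing.scale/= mulr1 mulrN; ring.
  move=> /andP[y0 yx]; rewrite mulr_ge0 ?(ltW y0)// sin_ge0_pi// (ltW y0)/=.
  by rewrite (le_trans (ltW yx)).
by rewrite /f !fctE sin0 mul0r subr0 subr_ge0.
Qed.

Lemma tan_ge x : 0 <= x < pi / 2 -> x <= tan x.
Proof.
move=> /andP[x0 xpi]; have c0 : 0 < cos x.
  by apply: cos_gt0_pihalf; rewrite xpi andbT (lt_le_trans _ x0)// oppr_lt0 divr_gt0// pi_gt0.
rewrite /tan ler_pdivlMr//; apply: mulr_cos_le_sin; rewrite x0/=.
by rewrite (le_trans (ltW xpi))// ler_pdivrMr// ler_peMr// ?pi_ge0// ler1n.
Qed.

(** The derivative of the right-hand side is 2 / (1 - z^2), that of the left-hand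
    side a partial sum of the corresponding geometric series. *)
Lemma ln_geo_le M z : 0 <= z < 1 ->
  \sum_(j < M) 2 / (j.*2.+1)%:R * z ^+ j.*2.+1 <= ln (1 + z) - ln (1 - z).
Proof.
move=> /andP[z0 z1].
pose p : {poly R} := \sum_(j < M) (2 / (j.*2.+1)%:R) *: 'X^(j.*2.+1).
have pz x : p.[x] = \sum_(j < M) 2 / (j.*2.+1)%:R * x ^+ j.*2.+1.
  by rewrite horner_sum; apply: eq_bigr => j _; rewrite hornerZ hornerXn.
have p'z x : p^`().[x] = 2 * \sum_(j < M) (x ^+ 2) ^+ j.
  rewrite (raddf_sum (@deriv R)) horner_sum mulr_sumr; apply: eq_bigr => j _.
  rewrite /= derivZ derivXn hornerZ hornerMn hornerXn /= -exprM mul2n.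
  by rewrite -[_ *+ j.*2.+1]mulr_natr; field; apply: lt0r_neq0.
pose f : R -> R := (@ln R \o (cst 1 + id)) - (@ln R \o (cst 1 - id)) - horner p.
have : f 0 <= f z.
  apply: (@nondecreasing_by_derivative f
     (fun y => (1 + y)^-1 + (1 - y)^-1 - p^`().[y])) => // y /andP[y0 yz].
    have a0 : 0 < 1 + y by rewrite ltr_pwDl.
    have b0 : 0 < 1 - y by rewrite subr_gt0 (le_lt_trans yz).
    have l1 : is_derive y 1 (@ln R \o (cst 1 + id)) (1 + y)^-1.
      have -> : (1 + y)^-1 = (1 + y)^-1 * (0 + 1) by rewrite add0r mulr1.
      apply: is_derive1_comp.
      by apply: is_derive1_ln; rewrite /=.
    have l2 : is_derive y 1 (@ln R \o (cst 1 - id)) (- (1 - y)^-1).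
      have -> : - (1 - y)^-1 = (1 - y)^-1 * (0 - 1) by rewrite sub0r mulrN1.
      apply: is_derive1_comp.
      by apply: is_derive1_ln; rewrite /=.
    by apply: is_derive_eq; rewrite opprK.
  have y1 : 0 <= y ^+ 2 < 1 by rewrite exprn_ge0 ?(ltW y0)//= expr_lt1 ?(ltW y0)// (lt_trans yz).
  have := geo_sum_le M y1; rewrite p'z => G.
  have a0 : 0 < 1 + y by lra.
  have b0 : 0 < 1 - y by lra.
  have -> : (1 + y)^-1 + (1 - y)^-1 = 2 * (1 - y ^+ 2)^-1.
    by field; rewrite !gt_eqF//; nra.
  by rewrite -mulrBr mulr_ge0// subr_ge0.
rewrite /f !fctE /= addr0 subr0 subrr add0r !pz big1; last by move=> j _; rewrite expr0n mulr0.
by rewrite oppr0 subr_ge0.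
Qed.

End Modular.

(** * The sum of the inverse squares of the odd integers *)

Section Basel.
Variable R : realType.
Implicit Types (x y u v w h d a s z : R).

Lemma cosB_pihalf x : cos (pi / 2 - x) = sin x.
Proof. by rewrite -cosN opprB cosBpihalf. Qed.

Lemma sinB_pihalf x : sin (pi / 2 - x) = cos x.
Proof. by rewrite -cosB_pihalf; congr cos; ring. Qed.

(** Passing from n to n + 1 replaces each angle 2 t by t and pi/2 - t, and
    1 / sin^2 t + 1 / cos^2 t = 4 / sin^2 (2 t). *)
Lemma sum_inv_sqr_sin n :
  \sum_(l < 2 ^ n) (sin (l.*2.+1%:R * pi / (4 * (2 ^ n)%:R)) ^+ 2)^-1 = 2 * (4 ^ n)%:R :> R.
Proof.
elim: n => [|n IH].
  rewrite !expn0 big_ord1 mulr1 mul1r mulr1.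
  have e : sin (pi / 4) = cos (pi / 4) :> R by rewrite -cosB_pihalf; congr cos; field.
  have := cos2Dsin2 (pi / 4 : R); rewrite e => E.
  suff -> : cos (pi / 4) ^+ 2 = 2^-1 :> R by rewrite invrK.
  by lra.
pose t l : R := l.*2.+1%:R * pi / (4 * (2 ^ n.+1)%:R).
have -> : \sum_(l < 2 ^ n.+1) (sin (t l) ^+ 2)^-1 = \sum_(l < 2 ^ n + 2 ^ n) (sin (t l) ^+ 2)^-1.
  by rewrite addnn -mul2n -expnS.
have N0 : 0 < (2 ^ n)%:R :> R by rewrite ltr0n expn_gt0.
rewrite big_split_ord/= [X in _ + X](reindex_inj rev_ord_inj)/= -big_split/=.
rewrite expnS natrM mulrCA -IH mulr_sumr; apply: eq_bigr => l _.
have -> : t (2 ^ n + (2 ^ n - l.+1))%N = pi / 2 - t l.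
  have e : ((2 ^ n + (2 ^ n - l.+1)).*2.+1 = 2 * 2 ^ n.+1 - l.*2.+1)%N.
    by rewrite expnS; have := ltn_ord l; lia.
  have le : (l.*2.+1 <= 2 * 2 ^ n.+1)%N by rewrite expnS; have := ltn_ord l; lia.
  by rewrite /t e natrB// natrM expnS natrM; field; rewrite gt_eqF.
rewrite sinB_pihalf.
have -> : l.*2.+1%:R * pi / (4 * (2 ^ n)%:R) = t l *+ 2.
  by rewrite /t expnS natrM -mulr_natr; field; rewrite gt_eqF.
rewrite sin_mulr2n.
have t0 : 0 < t l by rewrite /t divr_gt0 ?mulr_gt0 ?pi_gt0// ltr0n expn_gt0.
have t1 : t l < pi / 2.
  have : l.*2.+1%:R < (2 * 2 ^ n.+1)%:R :> R.
    by rewrite ltr_nat expnS; have := ltn_ord l; lia.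
  rewrite /t ltr_pdivrMr ?mulr_gt0 ?ltr0n ?expn_gt0// natrM => H.
  have -> : pi / 2 * (4 * (2 ^ n.+1)%:R) = 2 * (2 ^ n.+1)%:R * pi :> R by field.
  by rewrite ltr_pM2r ?pi_gt0.
have s0 : sin (t l) != 0 by rewrite gt_eqF// sin_gt0_pihalf// t0.
have c0 : cos (t l) != 0.
  by rewrite gt_eqF// cos_gt0_pihalf// t1 andbT (lt_trans _ t0)// oppr_lt0 divr_gt0// pi_gt0.
have E := cos2Dsin2 (t l).
have -> : (sin (t l) ^+ 2)^-1 + (cos (t l) ^+ 2)^-1 =
  (cos (t l) ^+ 2 + sin (t l) ^+ 2) / (sin (t l) ^+ 2 * cos (t l) ^+ 2).
  by field; rewrite s0 c0.
rewrite E -mulr_natr; field; by rewrite s0 c0.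
Qed.

Lemma inv_sqr_sin_le x : 0 < x < pi / 2 -> (sin x ^+ 2)^-1 <= (x ^+ 2)^-1 + 1.
Proof.
move=> /andP[x0 xpi].
have s0 : 0 < sin x by rewrite sin_gt0_pihalf// x0.
have c0 : 0 < cos x.
  by rewrite cos_gt0_pihalf// xpi andbT (lt_trans _ x0)// oppr_lt0 divr_gt0// pi_gt0.
have := @mulr_cos_le_sin _ x; rewrite (ltW x0)/= (le_trans (ltW xpi)) => [/(_ isT) le|]; last first.
  by rewrite ler_pdivrMr// ler_peMr// ?pi_ge0// ler1n.
have E := cos2Dsin2 x.
have -> : (sin x ^+ 2)^-1 = (cos x / sin x) ^+ 2 + 1.
  rewrite -{1}[_^-1]mul1r -{1}E; field; by rewrite gt_eqF.
rewrite lerD2r -exprVn lerXn2r ?nnegrE ?invr_ge0 ?divr_ge0 ?(ltW x0) ?(ltW s0) ?(ltW c0)//.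
by rewrite ler_pdivrMr// mulrC ler_pdivlMr// mulrC.
Qed.

(** The identity [sum_inv_sqr_sin] compared term by term with
    1 / sin^2 t <= 1 / t^2 + 1. *)
Lemma basel_odd_ge n :
  pi ^+ 2 / 8 - pi ^+ 2 / 16 / 2 ^+ n <= \sum_(l < 2 ^ n) (l.*2.+1%:R ^+ 2)^-1 :> R.
Proof.
have := sum_inv_sqr_sin n.
have N0 : 0 < (2 ^ n)%:R :> R by rewrite ltr0n expn_gt0.
have p0 := @pi_gt0 R.
have : \sum_(l < 2 ^ n) (sin (l.*2.+1%:R * pi / (4 * (2 ^ n)%:R)) ^+ 2)^-1 <=
   \sum_(l < 2 ^ n) (16 * (4 ^ n)%:R / pi ^+ 2 * (l.*2.+1%:R ^+ 2)^-1 + 1) :> R.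
  apply: ler_sum => l _; apply: le_trans (inv_sqr_sin_le _) _.
    rewrite divr_gt0 ?mulr_gt0//=.
    have : l.*2.+1%:R < (2 * 2 ^ n)%:R :> R.
      by rewrite ltr_nat; have := ltn_ord l; lia.
    rewrite ltr_pdivrMr ?mulr_gt0// natrM => H.
    have -> : pi / 2 * (4 * (2 ^ n)%:R) = 2 * (2 ^ n)%:R * pi :> R by field.
    by rewrite ltr_pM2r.
  rewrite lerD2r le_eqVlt; apply/orP; left; apply/eqP.
  have -> : (4 ^ n)%:R = (2 ^ n)%:R ^+ 2 :> R by rewrite -natrX -expnM mulnC expnM.
  move: ((2 ^ n)%:R : R) N0 (l.*2.+1%:R : R) (ltr0Sn R l.*2) => N N0 m m0.
  by move: (pi : R) p0 => p p0; field; rewrite !gt_eqF.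
rewrite big_split/= sumr_const card_ord -mulr_sumr => /[swap] ->.
move: (\sum_(l < _) _) => S.
have -> : (4 ^ n)%:R = (2 ^ n)%:R ^+ 2 :> R by rewrite -natrX -expnM mulnC expnM.
rewrite -[2 ^+ n]natrX; move: ((2 ^ n)%:R : R) N0 (pi : R) p0 => N N0 p p0 H.
have P0 : 0 < p ^+ 2 / (16 * N ^+ 2) :> R by rewrite divr_gt0 ?mulr_gt0 ?exprn_gt0.
have := ler_wpM2l (ltW P0) H.
rewrite mulrDr; have -> : p ^+ 2 / (16 * N ^+ 2) * (2 * N ^+ 2) = p ^+ 2 / 8 :> R.
  by field; rewrite gt_eqF.
have -> : p ^+ 2 / (16 * N ^+ 2) * (16 * N ^+ 2 / p ^+ 2 * S) = S :> R.
  by field; rewrite !gt_eqF.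
have -> : p ^+ 2 / (16 * N ^+ 2) * N = p ^+ 2 / 16 / N :> R.
  by field; rewrite gt_eqF.
by lra.
Qed.

End Basel.

(** * The modular estimate *)

Section ModularBound.
Local Open Scope classical_set_scope.
Local Open Scope ring_scope.
Variable R : realType.
Implicit Types (x y u v w h d a s z : R).

Lemma cvg_expR_comp (f : nat -> R) x : f @ \oo --> x -> (fun n => expR (f n)) @ \oo --> expR x.
Proof. by move=> fx; apply: (cvg_comp _ _ fx); exact: continuous_expR. Qed.

Lemma cvg_sum_ord n (F : 'I_n -> nat -> R) (b : 'I_n -> R) :
  (forall i, F i @ \oo --> b i) ->
  (fun k => \sum_(i < n) F i k) @ \oo --> \sum_(i < n) b i.
Proof. by move=> Fb; apply: cvg_big; [exact: add_continuous|move=> i _; exact: Fb]. Qed.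

Lemma tanhRE y : tanhR y = (1 - expR (- (2 * y))) / (1 + expR (- (2 * y))).
Proof.
rewrite /tanhR; have -> : - (2 * y) = - y + - y by ring.
rewrite expRD expRN; have := expR_gt0 y; move: (expR y) => Y Y0.
have ? : 0 < Y * Y by rewrite mulr_gt0.
by field; rewrite !gt_eqF//; nra.
Qed.

Lemma tanhR_exp_le M y : 0 < y ->
  tanhR y <= expR (- \sum_(j < M) 2 / (j.*2.+1)%:R * expR (- (2 * y)) ^+ j.*2.+1).
Proof.
move=> y0; set z := expR (- (2 * y)).
have z01 : 0 <= z < 1 by rewrite expR_ge0 expR_lt1 oppr_lt0 mulr_gt0.
have /andP[z0 z1] := z01.
have a0 : 0 < 1 + z by lra.
have b0 : 0 < 1 - z by lra.
rewrite tanhRE -/z -[leLHS]lnK ?posrE ?divr_gt0// ler_expR ln_div ?posrE//.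
by have := ln_geo_le M z01; lra.
Qed.

(** Take logarithms in [halfratio_le], truncate the power series of log tanh at M
    terms, and let the number of factors tend to infinity: the sums over the
    factors are geometric. *)
Lemma halfratio_exp_le d M : 0 < d ->
  dnratio (2 * d) 0 d <=
  expR (- (4 / d * \sum_(j < M) expR (- (j.*2.+1%:R * d)) / j.*2.+1%:R ^+ 2)).
Proof.
move=> d0.
pose r j := expR (- (2 * (j.*2.+1%:R * d))).
have m0 j : 0 < j.*2.+1%:R * d by rewrite mulr_gt0.
have r01 j : 0 <= r j < 1 by rewrite expR_ge0 expR_lt1 oppr_lt0 mulr_gt0.
have A_le k : dnratio (2 * d) 0 d <=
    expR (- (4 * \sum_(j < M) 2 / j.*2.+1%:R * (expR (- (j.*2.+1%:R * d)) *
      ((1 - r j ^+ k) / (1 - r j))))).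
  apply: le_trans (halfratio_le k d0) _.
  have -> x : expR (- (4 * x)) = expR (- x) ^+ 4 by rewrite -mulrN expRM_natl.
  rewrite lerXn2r ?nnegrE ?expR_ge0 ?(ltW (tanhprod_gt0 _ d0))//.
  apply: (@le_trans _ _ (\prod_(i < k) expR (- \sum_(j < M) 2 / (j.*2.+1)%:R *
     expR (- (2 * (i.*2.+1%:R * d / 2))) ^+ j.*2.+1))).
    apply: ler_prod => i _; have i0 : 0 < i.*2.+1%:R * d / 2 by rewrite divr_gt0.
    by rewrite ltW ?tanhR_gt0//= tanhR_exp_le.
  rewrite -expR_sum ler_expR sumrN lerN2 exchange_big/= le_eqVlt; apply/orP; left; apply/eqP.
  apply: eq_bigr => j _; rewrite -mulr_sumr; congr (_ * _).
  have /andP[_ r1] := r01 j; have q0 : 1 - r j != 0 by rewrite gt_eqF// subr_gt0.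
  have -> : (1 - r j ^+ k) / (1 - r j) = \sum_(i < k) r j ^+ i.
    have := subrX1 (r j) k; move: (\sum_(i < k) _) => S E.
    have -> : 1 - r j ^+ k = (1 - r j) * S by rewrite -opprB E; ring.
    by rewrite mulrAC divff// mul1r.
  rewrite mulr_sumr; apply: eq_bigr => i _.
  by rewrite -!expRM_natl -expRD; congr expR; rewrite -[i.*2.+1%:R]natr1 natr_double; field.
have C : (fun k => expR (- (4 * \sum_(j < M) 2 / j.*2.+1%:R * (expR (- (j.*2.+1%:R * d)) *
      ((1 - r j ^+ k) / (1 - r j)))))) @ \oo -->
    expR (- (4 * \sum_(j < M) 2 / j.*2.+1%:R * (expR (- (j.*2.+1%:R * d)) *
      ((1 - 0) / (1 - r j))))).
  apply: cvg_expR_comp.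
  apply: cvgN; apply: cvgM; first exact: cvg_cst.
  apply: cvg_sum_ord => i.
  apply: cvgM; first exact: cvg_cst.
  apply: cvgM; first exact: cvg_cst.
  apply: cvgM; last exact: cvg_cst.
  apply: cvgB; first exact: cvg_cst.
  by apply: cvg_expr; have /andP[r0 r1] := r01 i; rewrite ger0_norm.
have : dnratio (2 * d) 0 d <= expR (- (4 * \sum_(j < M) 2 / j.*2.+1%:R *
    (expR (- (j.*2.+1%:R * d)) * ((1 - 0) / (1 - r j))))).
  by apply: (ler_cvg_to (cvg_cst _) C); apply: nearW.
move=> /le_trans; apply; rewrite ler_expR lerN2 !mulr_sumr; apply: ler_sum => j _.
have mj := m0 j; have /andP[_ r1] := r01 j.
have q0 : 0 < 1 - r j by rewrite subr_gt0.
have r2 : 1 - r j <= 2 * (j.*2.+1%:R * d).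
  by have := expR_ge1Dx (- (2 * (j.*2.+1%:R * d))); rewrite -/(r j); lra.
rewrite subr0 mul1r; set E := expR _; have E0 : 0 <= E by exact: expR_ge0.
have n0 : 0 < j.*2.+1%:R :> R by [].
move: (j.*2.+1%:R) (r j) n0 mj q0 r2 E E0 {r1} => m rj n0 mj q0 r2 E E0.
have -> : 4 / d * (E / m ^+ 2) = 4 * (2 / m * (E * (2 * (m * d))^-1)).
  by field; rewrite !gt_eqF.
rewrite ler_wpM2l// ler_wpM2l ?divr_ge0 ?(ltW n0)// ler_wpM2l//.
by rewrite lef_pV2 ?posrE// mulr_gt0.
Qed.

(** B n is the half-period cross ratio for the parameter d / 2^n.  Landen's
    transformation bounds the 2^n-th power of B 0 / 4 by B n / 4, and taking 2^n-th
    roots of the crude estimate of B n leaves no constant behind as n grows. *)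
Lemma halfratio_modular d : 0 < d ->
  dnratio (2 * d) 0 d <= 4 * expR (- (pi ^+ 2 / (2 * d))).
Proof.
move=> d0; pose D n := d / 2 ^+ n.
have D0 n : 0 < D n by rewrite divr_gt0// exprn_gt0.
pose B n := dnratio (2 * D n) 0 (D n).
have B0 n : 0 <= B n by rewrite /B (halfratio_sqr 0 (D0 n)) sqr_ge0.
have Bd : dnratio (2 * d) 0 d = B 0%N by rewrite /B /D expr0 divr1.
have BS n : (B n / 4) ^+ 2 <= B n.+1 / 4.
  have := halfratio_landen (D0 n.+1).
  rewrite -/(B n.+1); have -> : 2 * D n.+1 = D n by rewrite /D exprS; field; rewrite expf_neq0.
  rewrite -/(B n); move: (B n) (B n.+1) => b b' H.
  have -> : (b / 4) ^+ 2 = b ^+ 2 / 16 by field.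
  by lra.
have Bexp M n : B n <= expR (- (4 / D n * \sum_(j < M) expR (- (j.*2.+1%:R * D n)) / j.*2.+1%:R ^+ 2)).
  exact: halfratio_exp_le.
have B40 n : 0 <= B n / 4 by rewrite divr_ge0.
rewrite Bd; clearbody B.
have Bn n : (B 0%N / 4) ^+ (2 ^ n) <= B n / 4.
  elim: n => [|n IH]; first by rewrite expn0 expr1.
  apply: le_trans (BS n); by rewrite expnSr exprM lerXn2r ?nnegrE ?exprn_ge0.
pose c M n := 4 / d * \sum_(j < M) expR (- (j.*2.+1%:R * D n)) / j.*2.+1%:R ^+ 2.
have Bc M n : B 0%N / 4 <= expR (- c M n).
  rewrite -(@ler_pXn2r _ (2 ^ n)) ?expn_gt0// ?nnegrE ?expR_ge0//.
  apply: le_trans (Bn n) _; apply: (@le_trans _ _ (B n)).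
    by rewrite ler_pdivrMr// ler_peMr// ler1n.
  apply: le_trans (Bexp M n) _.
  rewrite -expRM_natl ler_expR mulrN lerN2 /c le_eqVlt; apply/orP; left; apply/eqP.
  rewrite mulrA; congr (_ * _); rewrite /D natrX; field.
  by rewrite expf_neq0// gt_eqF.
have Bs M : B 0%N / 4 <= expR (- (4 / d * \sum_(j < M) (j.*2.+1%:R ^+ 2)^-1)).
  have C : (fun n => expR (- c M n)) @ \oo -->
      expR (- (4 / d * \sum_(j < M) expR (- (j.*2.+1%:R * 0)) / j.*2.+1%:R ^+ 2)).
    apply: cvg_expR_comp.
    apply: cvgN; apply: cvgM; first exact: cvg_cst.
    apply: cvg_sum_ord => j.
    apply: cvgM; last exact: cvg_cst.
    apply: cvg_expR_comp.
    apply: cvgN; apply: cvgM; first exact: cvg_cst.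
    rewrite -[X in _ --> X](mulr0 d); apply: cvgM; first exact: cvg_cst.
    under eq_fun do rewrite -exprVn.
    by apply: cvg_expr; rewrite ger0_norm ?invr_ge0// invf_lt1// ltr1n.
  apply: le_trans (_ : expR (- (4 / d * \sum_(j < M) expR (- (j.*2.+1%:R * 0)) / j.*2.+1%:R ^+ 2)) <= _).
    by apply: (ler_cvg_to (cvg_cst _) C); apply: nearW.
  rewrite ler_expR lerN2 ler_wpM2l ?divr_ge0 ?(ltW d0)//.
  rewrite le_eqVlt; apply/orP; left; apply/eqP.
  by apply: eq_bigr => j _; rewrite mulr0 oppr0 expR0 mul1r.
have Bb n : B 0%N / 4 <= expR (- (4 / d * (pi ^+ 2 / 8 - pi ^+ 2 / 16 * 2^-1 ^+ n))).
  apply: le_trans (Bs (2 ^ n)%N) _; rewrite ler_expR lerN2 ler_wpM2l ?divr_ge0 ?(ltW d0)//.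
  rewrite exprVn. exact: basel_odd_ge.
have C : (fun n => expR (- (4 / d * (pi ^+ 2 / 8 - pi ^+ 2 / 16 * 2^-1 ^+ n)))) @ \oo -->
   expR (- (4 / d * (pi ^+ 2 / 8 - pi ^+ 2 / 16 * 0))).
  apply: cvg_expR_comp.
  apply: cvgN; apply: cvgM; first exact: cvg_cst.
  apply: cvgB; first exact: cvg_cst.
  apply: cvgM; first exact: cvg_cst.
  by apply: cvg_expr; rewrite ger0_norm ?invr_ge0// invf_lt1// ltr1n.
have : B 0%N / 4 <= expR (- (4 / d * (pi ^+ 2 / 8 - pi ^+ 2 / 16 * 0))).
  by apply: (ler_cvg_to (cvg_cst _) C); apply: nearW.
rewrite mulr0 subr0 ler_pdivrMr// mulrC.
have -> : 4 / d * (pi ^+ 2 / 8) = pi ^+ 2 / (2 * d) :> R.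
  by move: (pi : R) => p; field; rewrite gt_eqF.
by [].
Qed.

End ModularBound.

(** * Zolotarev's problem on two symmetric intervals *)

Section Zolotarev.
Local Open Scope classical_set_scope.
Local Open Scope ring_scope.
Variable R : realType.
Implicit Types (x y u v w h d a s z : R).

Lemma nodeprod_modular k d u : 0 < d -> (0 < k)%N -> 0 <= u ->
  nodeprod k d u <= 2 * expR (- (pi ^+ 2 / (4 * d))).
Proof.
move=> d0 k0 u0.
have X0 : 0 <= nodeprod k d u by apply: prodr_ge0 => i _.
have := halfratio_ge d0 X0 (fun n => nodeprod_le n d0 k0 u0).
move=> /le_trans/(_ (halfratio_modular d0)) H.
rewrite -ler_sqr ?nnegrE// ?mulr_ge0 ?expR_ge0//; apply: le_trans H _.
rewrite exprMn -expRM_natl le_eqVlt; apply/orP; left; apply/eqP.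
have -> : 2%:R * (- (pi ^+ 2 / (4 * d))) = - (pi ^+ 2 / (2 * d)) :> R.
  by move: (pi : R) => p; field; rewrite gt_eqF.
by congr (_ * _); ring.
Qed.

Lemma sechsum_scale_le c c' u v h : 0 < h ->
  (forall j, c * sech (u + j%:R * h) <= c' * sech (v + j%:R * h)) ->
  c * sechsum h u <= c' * sechsum h v.
Proof.
move=> h0 cc'.
have cu : (fun n => c * sechpart n h u) @ \oo --> c * sechsum h u.
  by apply: cvgM; [exact: cvg_cst|exact: sechsum_cvg].
have cv : (fun n => c' * sechpart n h v) @ \oo --> c' * sechsum h v.
  by apply: cvgM; [exact: cvg_cst|exact: sechsum_cvg].
apply: (ler_cvg_to cu cv); apply: nearW => n; rewrite /sechpart !mulr_sumr.
by apply: ler_sum => j _; exact: cc'.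
Qed.

(** Both exponentials in the denominator change by a factor at most
    exp |y - x|. *)
Lemma sech_lip x y : sech y <= expR `|y - x| * sech x.
Proof.
rewrite /sech mulrCA ler_pM2l// -[expR `|_|]invrK -invfM.
rewrite lef_pV2 ?posrE ?mulr_gt0 ?invr_gt0 ?expRDN_gt0 ?expR_gt0//.
rewrite -expRN mulrDr -!expRD; apply: lerD; rewrite ler_expR.
  by have := ler_norm (- (y - x)); rewrite normrN; lra.
by have := ler_norm (y - x); lra.
Qed.

Lemma dnsum_lip h x y : 0 < h -> dnsum h y <= expR `|y - x| * dnsum h x.
Proof.
move=> h0; rewrite /dnsum mulrDr; apply: lerD.
  rewrite -[leLHS]mul1r; apply: sechsum_scale_le => // j; rewrite mul1r.
  have -> : y - x = (y + j%:R * h) - (x + j%:R * h) by ring.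
  exact: sech_lip.
rewrite -[leLHS]mul1r; apply: sechsum_scale_le => // j; rewrite mul1r.
have -> : y - x = - ((h - y + j%:R * h) - (h - x + j%:R * h)) by ring.
by rewrite normrN; exact: sech_lip.
Qed.

Lemma dnsum_continuous h : 0 < h -> continuous (dnsum h).
Proof.
move=> h0 x.
have c1 : (fun y => `|y - x|) @ x --> (0 : R).
  rewrite -[X in _ --> X](normr0 R) -(subrr x).
  by apply: cvg_norm; apply: cvgB; [exact: cvg_id|exact: cvg_cst].
have c2 : (fun y => - `|y - x|) @ x --> (0 : R).
  by rewrite -oppr0; apply: cvgN.
apply: (@squeeze_cvgr _ _ _ _ (fun y => expR (- `|y - x|) * dnsum h x)
                              (fun y => expR `|y - x| * dnsum h x)).
- apply: nearW => y; rewrite dnsum_lip// andbT expRN mulrC.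
  by rewrite ler_pdivrMr ?expR_gt0// mulrC distrC dnsum_lip.
- rewrite -[X in _ --> X]mul1r; apply: cvgM; last exact: cvg_cst.
  rewrite -[X in _ --> X]expR0.
  by apply: (cvg_comp _ _ c2); exact: continuous_expR.
- rewrite -[X in _ --> X]mul1r; apply: cvgM; last exact: cvg_cst.
  rewrite -[X in _ --> X]expR0.
  by apply: (cvg_comp _ _ c1); exact: continuous_expR.
Qed.

Lemma sech_ge x : 0 <= x -> expR (- x) <= sech x.
Proof.
move=> x0; rewrite /sech ler_pdivlMr ?expRDN_gt0// mulrDr -!expRD addNr expR0.
have : expR (- x + - x) <= 1 by rewrite expR_le1; lra.
by lra.
Qed.

(** Term by term comparison of the two lattice sums, the central term of the one
    at 0 being 1 and its neighbours having slack. *)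
Lemma dnsum_range h : 0 < h -> expR (h / 2) / 4 * dnsum h (h / 2) <= dnsum h 0.
Proof.
move=> h0; rewrite /dnsum subr0.
have -> : h - h / 2 = h / 2 by field.
rewrite (sechsum_rec 0)// (sechsum_rec (h / 2))// add0r sech0.
have A : expR (h / 2) * sech (h / 2) <= 2.
  apply: le_trans (ler_wpM2l (expR_ge0 _) (sech_ub _)) _.
  by rewrite mulrCA expRxMexpNx_1 mulr1.
have B : expR (h / 2) * sechsum h (h / 2 + h) <= 4 * sechsum h h.
  apply: sechsum_scale_le => // j.
  have hj : 0 <= h + j%:R * h by rewrite addr_ge0 ?mulr_ge0 ?(ltW h0).
  apply: (@le_trans _ _ (2 * expR (- (h + j%:R * h)))).
    apply: le_trans (ler_wpM2l (expR_ge0 _) (sech_ub _)) _.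
    by rewrite mulrCA ler_pM2l// -expRD ler_expR; lra.
  by have := sech_ge hj; have := expR_ge0 (- (h + j%:R * h)); lra.
by lra.
Qed.

(** With h = 4 ln (2 B), a multiple of [dnsum h] takes all values between 1/B and B
    by [dnsum_range] and continuity, and the nodes are its values at odd multiples
    of h / (4 k). *)
Lemma zolotarev_nodes (B : R) k : 1 <= B ->
  exists2 x : nat -> R, forall l, 0 < x l &
    forall y, B^-1 <= y <= B ->
      \prod_(l < k) `|(y - x l) / (y + x l)| <=
        2 * expR (- (pi ^+ 2 * k%:R / (4 * ln (2 * B)))).
Proof.
move=> B1; have B0 : 0 < B by rewrite (lt_le_trans _ B1).
case: (posnP k) => [->|k0].
  exists (fun=> 1) => // y _; rewrite big_ord0 mulr0 mul0r oppr0 expR0 mulr1.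
  by rewrite ler1n.
pose h : R := 4 * ln (2 * B).
have h0 : 0 < h by rewrite mulr_gt0// ln_gt0//; lra.
have kR : 0 < k%:R :> R by rewrite ltr0n.
pose d := h / (4 * k%:R).
have d0 : 0 < d by rewrite divr_gt0// mulr_gt0.
have hd : k%:R * (4 * d) = h by rewrite /d; field; rewrite gt_eqF.
pose P0 := dnsum h 0.
have P00 : 0 < P0 by exact: dnsum_gt0.
pose c := B / P0.
have c0 : 0 < c by rewrite divr_gt0.
have rng : dnsum h (h / 2) * c <= B^-1.
  have := dnsum_range h0.
  have -> : expR (h / 2) = (2 * B) ^+ 2.
    have -> : h / 2 = 2%:R * ln (2 * B) by rewrite /h; field.
    by rewrite expRM_natl lnK// posrE mulr_gt0.
  rewrite -/P0 /c => H.
  rewrite mulrA ler_pdivrMr// ler_pdivlMl//.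
  by apply: le_trans _ H; rewrite le_eqVlt; apply/orP; left; apply/eqP; field.
exists (fun l => c * dnsum h (l.*2.+1%:R * d)) => [l|y /andP[y1 y2]].
  by rewrite mulr_gt0// dnsum_gt0.
have [u uh uy] : exists2 u, u \in `[0, h / 2] & dnsum h u = y / c.
  apply: IVT; first by rewrite divr_ge0// ltW.
    by apply: continuous_subspaceT; exact: dnsum_continuous.
  rewrite ge_min le_max; apply/andP; split; apply/orP; [right|left].
    by rewrite ler_pdivlMr//; apply: le_trans rng y1.
  rewrite ler_pdivrMr// -/P0 /c mulrCA divff ?mulr1// gt_eqF//.
have u0 : 0 <= u by move: uh; rewrite in_itv/= => /andP[].
have -> : \prod_(l < k) `|(y - c * dnsum h (l.*2.+1%:R * d)) / (y + c * dnsum h (l.*2.+1%:R * d))|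
    = nodeprod k d u.
  rewrite /nodeprod hd; apply: eq_bigr => l _; congr `|_|; rewrite /dnratio uy.
  have := dnsum_gt0 (l.*2.+1%:R * d) h0; move: (dnsum h _) => D D0.
  have y0 : 0 < y by apply: lt_le_trans y1; rewrite invr_gt0.
  by field; rewrite (gt_eqF c0) gt_eqF// addr_gt0// mulr_gt0.
apply: le_trans (nodeprod_modular d0 k0 u0) _.
rewrite ler_pM2l// ler_expR lerN2 /d -/h le_eqVlt; apply/orP; left; apply/eqP.
by move: (pi : R) => p; field; rewrite !gt_eqF.
Qed.

End Zolotarev.

(** * Parseval's identity at the roots of -1 *)

Section Parseval.
Local Open Scope complex_scope.
Local Open Scope ring_scope.
Variable R : realType.
Local Notation C := R[i].
Implicit Types (s t : R).

Definition expi t : C := cos t +i* sin t.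

Lemma expiD s t : expi (s + t) = expi s * expi t.
Proof. by rewrite /expi cosD sinD; apply/eqP; rewrite eq_complex /= eqxx/= addrC. Qed.

Lemma expi0 : expi 0 = 1.
Proof. by rewrite /expi cos0 sin0. Qed.

Lemma expi_conj t : (expi t)^* = expi (- t).
Proof. by rewrite /expi cosN sinN. Qed.

Lemma expiX t n : expi t ^+ n = expi (n%:R * t).
Proof.
elim: n => [|n IH]; first by rewrite mul0r expi0.
by rewrite exprS IH -expiD -natr1; congr expi; ring.
Qed.

Lemma expi2pi n : expi (n%:R * (2 * pi)) = 1.
Proof.
rewrite -expiX; have -> : expi (2 * pi) = 1; last exact: expr1n.
by rewrite /expi mulrC mulr_natr cos2pi sin2pi.
Qed.

Lemma expi_neq1 t : sin t != 0 -> expi (2 * t) != 1.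
Proof.
move=> st; rewrite /expi eq_complex/= negb_and; apply/orP; left.
rewrite mulrC mulr_natr cos_mulr2n; apply: contra st => /eqP E.
have := cos2Dsin2 t; move: E; rewrite -mulr_natr => E F.
by rewrite -sqrf_eq0; apply/eqP; lra.
Qed.

Definition rootN1 n l := expi (l.*2.+1%:R * pi / n%:R).

(** Off the diagonal the sum is geometric with ratio exp(2 i t) <> 1, and the terms
    of rank 0 and n agree since n t is a multiple of pi. *)
Lemma sum_rootN1 n (a b : 'I_n) :
  \sum_(l < n) rootN1 n l ^+ a * (rootN1 n l)^* ^+ b = (a == b)%:R * n%:R.
Proof.
have n0 : (0 < n)%N by case: n a {b} => // -[].
have nR : 0 < n%:R :> R by rewrite ltr0n.
pose t : R := (a%:R - b%:R) * pi / n%:R.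
have E l : rootN1 n l ^+ a * (rootN1 n l)^* ^+ b = expi (l.*2.+1%:R * t).
  rewrite /rootN1 expi_conj !expiX -expiD; congr expi; rewrite /t.
  by move: (pi : R) => p; field; rewrite gt_eqF.
under eq_bigr do rewrite E.
have [ab|ab] := eqVneq a b.
  have t0 : t = 0 by rewrite /t ab subrr !mul0r.
  under eq_bigr do rewrite t0 mulr0 expi0.
  by rewrite sumr_const card_ord mul1r.
rewrite mul0r.
have st : sin t != 0.
  have S (c d : 'I_n) : (d < c)%N -> sin ((c%:R - d%:R) * pi / n%:R) != 0 :> R.
    move=> dc; rewrite gt_eqF// sin_gt0_pi// -natrB ?(ltnW dc)//.
    rewrite divr_gt0 ?mulr_gt0 ?pi_gt0 ?ltr0n ?subn_gt0//=.
    rewrite ltr_pdivrMr// mulrC ltr_pM2l ?pi_gt0// ltr_nat.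
    by rewrite (leq_ltn_trans (leq_subr _ _)).
  have [lt|lt|e] := ltngtP a b; last by move/val_inj: e ab => ->; rewrite eqxx.
    rewrite -oppr_eq0 -sinN; have -> : - t = (b%:R - a%:R) * pi / n%:R by rewrite /t; ring.
    exact: S.
  exact: S.
apply: (mulIf (_ : expi (2 * t) - 1 != 0)); first by rewrite subr_eq0 expi_neq1.
rewrite mul0r mulr_suml.
have T l : expi (l.*2.+1%:R * t) * (expi (2 * t) - 1) =
    expi (l.+1.*2.+1%:R * t) - expi (l.*2.+1%:R * t).
  rewrite mulrBr mulr1 -expiD; congr (expi _ - _).
  by rewrite -![_.*2.+1%:R]natr1 !natr_double -natr1; ring.
under eq_bigr do rewrite T.
rewrite -(big_mkord xpredT (fun l => expi (l.+1.*2.+1%:R * t) - expi (l.*2.+1%:R * t))).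
rewrite telescope_sumr//; apply/eqP; rewrite subr_eq0; apply/eqP.
have -> : n.*2.+1%:R * t = 1 * t + a%:R * (2 * pi) + - (b%:R * (2 * pi)).
  rewrite -[_.*2.+1%:R]natr1 !natr_double /t.
  by move: (pi : R) => p; field; rewrite gt_eqF.
by rewrite 2!expiD -(expi_conj (b%:R * _)) !expi2pi rmorph1 !mulr1 ?mul1r.
Qed.

Lemma parseval n (p : {poly C}) : (size p <= n)%N ->
  \sum_(l < n) `|p.[rootN1 n l]| ^+ 2 = n%:R * \sum_(a < n) `|p`_a| ^+ 2.
Proof.
move=> pn.
transitivity (\sum_(l < n) \sum_(a < n) \sum_(b < n) p`_a * (p`_b)^* *
    (rootN1 n l ^+ a * (rootN1 n l)^* ^+ b)).
  apply: eq_bigr => l _; rewrite sqr_normc (horner_coef_wide _ pn) rmorph_sum/=.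
  rewrite mulr_suml; apply: eq_bigr => a _; rewrite mulr_sumr; apply: eq_bigr => b _.
  by rewrite rmorphM rmorphXn/=; ring.
rewrite exchange_big mulr_sumr; apply: eq_bigr => a _; rewrite exchange_big/=.
rewrite (bigD1 a)//= [X in _ + X]big1 ?addr0.
  by rewrite -mulr_sumr sum_rootN1 eqxx mul1r sqr_normc mulrC.
by move=> b ba; rewrite -mulr_sumr sum_rootN1 eq_sym (negbTE ba) mul0r mulr0.
Qed.

End Parseval.

(** * From rational functions on the line to polynomials on the circle *)

Section ZolotarevPolynomials.
Local Open Scope complex_scope.
Local Open Scope ring_scope.
Variable R : realType.
Local Notation C := R[i].
Variables (k : nat) (x : nat -> R).

(** For s = 'i this is (z - 1) (c(z) - y) with c(z) = i(z + 1)/(z - 1) the Cayley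
    variable; for s = - 'i it is (z - 1) (- c(z) - y). *)
Definition zfac (s : C) (y : R) : {poly C} := s *: ('X + 1) - y%:C *: ('X - 1).
Definition zpol (s : C) : {poly C} := \prod_(l < k) zfac s (x l).

Definition zP := zpol 'i%C.
Definition zPc := zpol (- 'i%C).
(** Up to normalization: denominator and numerator of (r + r^-1) / 2 for
    r = zP / zPc.  On the real line r has modulus 1, which gives the decomposition
    of [zden ^+ 2] into two squares with [zrem] as the second one. *)
Definition zden := zP * zPc.
Definition znum := (2^-1 : C) *: (zP ^+ 2 + zPc ^+ 2).
Definition zrem := ((2 * 'i%C)^-1 : C) *: (zP ^+ 2 - zPc ^+ 2).

Lemma map_zpol s : map_poly Num.conj (zpol s) = zpol s^*.
Proof.
rewrite rmorph_prod; apply: eq_bigr => l _.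
rewrite /zfac rmorphB/= !map_polyZ/= rmorphD rmorphB/= map_polyX rmorph1.
by congr (_ - _ *: _); apply/eqP; rewrite eq_complex/= oppr0 !eqxx.
Qed.

Lemma conj_i : ('i%C : C)^* = - 'i%C.
Proof. by apply/eqP; rewrite eq_complex/= oppr0 !eqxx. Qed.

Lemma conj_half : (2^-1 : C)^* = 2^-1.
Proof. by rewrite fmorphV rmorph_nat. Qed.

Lemma conj_half_i : ((2 * 'i%C)^-1 : C)^* = - (2 * 'i%C)^-1.
Proof. by rewrite fmorphV rmorphM/= conj_i rmorph_nat mulrN invrN. Qed.

Lemma map_zP : map_poly Num.conj zP = zPc.
Proof. by rewrite map_zpol conj_i. Qed.

Lemma map_zPc : map_poly Num.conj zPc = zP.
Proof. by rewrite map_zpol rmorphN/= conj_i opprK. Qed.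

Lemma map_zden : map_poly Num.conj zden = zden.
Proof. by rewrite rmorphM/= map_zP map_zPc mulrC. Qed.

Lemma map_znum : map_poly Num.conj znum = znum.
Proof.
rewrite map_polyZ rmorphD !rmorphXn/= map_zP map_zPc addrC; congr (_ *: _).
exact: conj_half.
Qed.

Lemma map_zrem : map_poly Num.conj zrem = zrem.
Proof.
rewrite map_polyZ rmorphB !rmorphXn/= map_zP map_zPc conj_half_i.
by rewrite scaleNr -scalerN opprB.
Qed.

(** (P Q)^2 = ((P^2 + Q^2) / 2)^2 - ((P^2 - Q^2) / 2)^2. *)
Lemma zden_sqr : zden ^+ 2 = znum ^+ 2 + zrem ^+ 2.
Proof.
rewrite /zden /znum /zrem !exprZn.
have -> : ((2 * 'i%C)^-1 : C) ^+ 2 = - (2^-1 ^+ 2).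
  by rewrite invfM exprMn [X in _ * X]exprVn sqr_i invrN1 mulrN1.
rewrite scaleNr -scalerBr.
have -> : (zP ^+ 2 + zPc ^+ 2) ^+ 2 - (zP ^+ 2 - zPc ^+ 2) ^+ 2 = (2 ^+ 2 : C) *: (zP * zPc) ^+ 2.
  rewrite -natrX scaler_nat -mulr_natr natrX; ring.
by rewrite scalerA exprVn mulVf ?scale1r// expf_neq0.
Qed.

Lemma zden_neq0 : zden != 0.
Proof.
suff nz (s : C) : s != 0 -> zpol s != 0.
  by rewrite mulf_neq0// nz// ?oppr_eq0 eq_complex/= negb_and oner_eq0 orbT.
move=> s0; apply/prodf_neq0 => l _; apply: contra s0 => /eqP/(congr1 (horner^~ 1)).
by rewrite /zfac !hornerE/= subrr mulr0 subr0 => /eqP; rewrite -[1 + 1]/(2%:R) mulf_eq0 pnatr_eq0 orbF.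
Qed.

Lemma size_zpol s : (size (zpol s) <= k.+1)%N.
Proof.
rewrite /zpol; elim: k => [|m IH]; first by rewrite big_ord0 size_poly1.
rewrite big_ord_recr/=; apply: leq_trans (size_polyMleq _ _) _.
have : (size (zfac s (x m)) <= 2)%N.
  rewrite /zfac; apply: leq_trans (size_polyD _ _) _; rewrite geq_max size_polyN.
  rewrite !(leq_trans (size_scale_leq _ _))// ?size_XaddC// size_XsubC//.
by move=> S2; rewrite -subn1 leq_subLR add1n (leq_trans (leq_add IH S2))// addn2.
Qed.

Lemma size_zden_znum_zrem :
  [/\ (size zden <= k.*2.+1)%N, (size znum <= k.*2.+1)%N & (size zrem <= k.*2.+1)%N].
Proof.
have M s t : (size (zpol s * zpol t)%R <= k.*2.+1)%N.
  apply: leq_trans (size_polyMleq _ _) _.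
  rewrite -subn1 leq_subLR add1n (leq_trans (leq_add (size_zpol s) (size_zpol t)))//.
  by rewrite addSn addnS addnn.
split; first exact: M.
- apply: leq_trans (size_scale_leq _ _) _; apply: leq_trans (size_polyD _ _) _.
  by rewrite geq_max !expr2 !M.
- apply: leq_trans (size_scale_leq _ _) _; apply: leq_trans (size_polyD _ _) _.
  by rewrite size_polyN geq_max !expr2 !M.
Qed.

(** At angle 2 f, the numbers z + 1 and z - 1 are exp(i f) times 2 cos f and
    2 i sin f.  Hence all factors are real multiples of the same complex number. *)
Lemma zfac_expi e y (f : R) :
  (zfac (e%:C * 'i%C) y).[expi (2 * f)] = 2 * 'i%C * expi f * (e * cos f - y * sin f)%:C.
Proof.
rewrite /zfac !hornerE/=.
have -> : expi (2 * f) = expi f * expi f by rewrite -expiD; congr expi; ring.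
have Ep : expi f * expi f + 1 = expi f * (2 * cos f)%:C.
  rewrite -(expi0 R) -(subrr f) expiD -mulrDr; congr (_ * _).
  by rewrite /expi cosN sinN; apply/eqP; rewrite eq_complex/= subrr eqxx andbT; apply/eqP; ring.
have Em : expi f * expi f - 1 = expi f * ('i%C * (2 * sin f)%:C).
  rewrite -(expi0 R) -(subrr f) expiD -mulrBr; congr (_ * _).
  rewrite /expi cosN sinN; apply/eqP; rewrite eq_complex/=; apply/andP.
  by split; apply/eqP; ring.
rewrite Ep Em !rmorphB/= !rmorphM/= rmorph_nat; ring.
Qed.

Lemma zpol_expi (e f : R) :
  (zpol (e%:C * 'i%C)).[expi (2 * f)] =
  (2 * 'i%C * expi f) ^+ k * (\prod_(l < k) (e * cos f - x l * sin f))%:C.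
Proof.
rewrite horner_prod rmorph_prod/= -[k in _ ^+ k]card_ord -prodr_const -big_split/=.
by apply: eq_bigr => l _; rewrite zfac_expi.
Qed.

(** Up to a common factor the two values are a b and (a^2 + b^2) / 2; the ratio of
    a to b, or its inverse, is the value r of Zolotarev's function. *)
Lemma zden_le_znum (f t : R) (a := \prod_(l < k) (cos f - x l * sin f))
    (b := \prod_(l < k) (- cos f - x l * sin f)) :
  0 <= t -> `|a| <= t * `|b| \/ `|b| <= t * `|a| ->
  `|zden.[expi (2 * f)]| <= (2 * t)%:C * `|znum.[expi (2 * f)]|.
Proof.
move=> t0 ab; pose c : C := (2 * 'i%C * expi f) ^+ k.
have eP : zP.[expi (2 * f)] = c * a%:C.
  rewrite /zP; have -> : 'i%C = 1%:C * 'i%C :> C by rewrite mul1r.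
  by rewrite zpol_expi; congr (_ * _%:C); apply: eq_bigr => l _; rewrite mul1r.
have ePc : zPc.[expi (2 * f)] = c * b%:C.
  rewrite /zPc; have -> : - 'i%C = (-1)%:C * 'i%C :> C by rewrite rmorphN1 mulN1r.
  by rewrite zpol_expi; congr (_ * _%:C); apply: eq_bigr => l _; rewrite mulN1r.
have -> : zden.[expi (2 * f)] = c ^+ 2 * (a * b)%:C.
  by rewrite hornerM eP ePc rmorphM/=; ring.
have -> : znum.[expi (2 * f)] = c ^+ 2 * ((a ^+ 2 + b ^+ 2) / 2)%:C.
  rewrite hornerZ hornerD !horner_exp eP ePc.
  by rewrite rmorphM rmorphD !rmorphXn fmorphV rmorph_nat/=; ring.
rewrite !normrM mulrCA ler_wpM2l ?normr_ge0//.
have nr (r : R) : `|r%:C| = `|r|%:C by rewrite normc_def/= expr0n addr0 sqrtr_sqr.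
rewrite !nr -rmorphM/= lecR [`|a * b|]normrM.
have ab0 : 0 <= (a ^+ 2 + b ^+ 2) / 2 by rewrite divr_ge0// addr_ge0 ?sqr_ge0.
rewrite (ger0_norm ab0).
have -> : 2 * t * ((a ^+ 2 + b ^+ 2) / 2) = t * (a ^+ 2 + b ^+ 2) by field.
rewrite -(real_normK (num_real a)) -(real_normK (num_real b)).
have := normr_ge0 a; have := normr_ge0 b; move: ab; move: `|a| `|b| => A B ab B0 A0.
have tA : 0 <= t * A ^+ 2 by rewrite mulr_ge0 ?sqr_ge0.
have tB : 0 <= t * B ^+ 2 by rewrite mulr_ge0 ?sqr_ge0.
case: ab => AB.
  by have := ler_wpM2r B0 AB; lra.
by have := ler_wpM2l A0 AB; lra.
Qed.

(** Divide by sin f: the variable is cot f, which lies between f0 and 1 / f0 because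
    tan t >= t. *)
Lemma zden_le_znum_cot (f f0 t : R) (B := f0^-1) :
  (forall l, 0 < x l) ->
  (forall y, B^-1 <= y <= B -> \prod_(l < k) `|(y - x l) / (y + x l)| <= t) ->
  0 < f0 -> f0 <= f <= pi / 2 - f0 ->
  \prod_(l < k) `|cos f - x l * sin f| <= t * \prod_(l < k) `|cos f + x l * sin f|.
Proof.
move=> x0 xt f00 /andP[f0f fpi].
have fgt0 : 0 < f by exact: lt_le_trans f0f.
have fpi2 : f < pi / 2 by rewrite (le_lt_trans fpi)// ltrBlDr ltrDl.
have s0 : 0 < sin f by rewrite sin_gt0_pihalf// fgt0.
have c0 : 0 < cos f.
  by rewrite cos_gt0_pihalf// fpi2 andbT (lt_trans _ fgt0)// oppr_lt0 divr_gt0// pi_gt0.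
pose y := cos f / sin f.
have y0 : 0 < y by rewrite divr_gt0.
have yB : B^-1 <= y <= B.
  apply/andP; split.
    rewrite invrK; apply: (@le_trans _ _ (pi / 2 - f)); first by lra.
    have -> : y = tan (pi / 2 - f) by rewrite /tan sinB_pihalf cosB_pihalf.
    by apply: tan_ge; apply/andP; split; lra.
  rewrite ler_pdivrMr// /B ler_pdivlMl//.
  apply: le_trans (_ : f * cos f <= _); first by rewrite ler_pM2r.
  apply: mulr_cos_le_sin; rewrite (ltW fgt0)/= (le_trans (ltW fpi2))//.
  by rewrite ler_pdivrMr// ler_peMr ?pi_ge0// ler1n.
have := xt y yB => /(ler_wpM2r (_ : 0 <= \prod_(l < k) `|cos f + x l * sin f|)).
move=> /(_ (prodr_ge0 _ (fun i _ => normr_ge0 _))); apply: le_trans.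
rewrite -big_split/= le_eqVlt; apply/orP; left; apply/eqP; apply: eq_bigr => l _.
rewrite -normrM; congr `|_|; rewrite /y; have := x0 l; move: (x l) => X X0.
field; rewrite (gt_eqF s0) gt_eqF// addr_gt0// mulr_gt0//.
Qed.

Lemma zden_le_znum_rootN1 m l (t : R) (B := m.*2.*2%:R / pi) :
  (forall l, 0 < x l) -> 0 <= t ->
  (forall y, B^-1 <= y <= B -> \prod_(l < k) `|(y - x l) / (y + x l)| <= t) ->
  (l < m.*2)%N ->
  `|zden.[rootN1 R m.*2 l]| <= (2 * t)%:C * `|znum.[rootN1 R m.*2 l]|.
Proof.
move=> x0 t0 xt lm; have p0 := @pi_gt0 R.
have M0 : 0 < m.*2%:R :> R by rewrite ltr0n; case: m lm {B xt}.
pose f0 : R := pi / m.*2.*2%:R.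
have f00 : 0 < f0 by rewrite divr_gt0// natr_double mulr_gt0.
have pf0 : pi = m.*2.*2%:R * f0 :> R.
  by rewrite /f0 mulrCA divff ?mulr1// natr_double mulf_neq0// gt_eqF.
have BE : B = f0^-1 by rewrite /B /f0 invf_div.
have xt' y : f0^-1^-1 <= y <= f0^-1 -> \prod_(l < k) `|(y - x l) / (y + x l)| <= t.
  by rewrite -BE; exact: xt.
have mid j : (j < m)%N -> f0 <= j.*2.+1%:R * f0 <= pi / 2 - f0.
  move=> jm; rewrite pf0 !natr_double -[j.*2.+1%:R]natr1 natr_double.
  have : j%:R + 1 <= m%:R :> R by rewrite natr1 ler_nat.
  by have : 0 <= j%:R :> R by []; nra.
pose f : R := l.*2.+1%:R * f0.
have -> : rootN1 R m.*2 l = expi (2 * f).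
  rewrite /rootN1 /f /f0; congr expi; rewrite [m.*2.*2%:R]natr_double.
  by move: (pi : R) => p; field; rewrite gt_eqF.
apply: zden_le_znum => //; rewrite !normr_prod.
have [lt|ge] := ltnP l m.
  left; rewrite [X in _ <= t * X](eq_bigr (fun l : 'I_k => `|cos f + x l * sin f|)).
    by apply: (@zden_le_znum_cot f f0) => //; exact: mid.
  by move=> i _; rewrite -normrN; congr `|_|; ring.
(* past pi/2 the reflection phi -> pi - phi exchanges the two products *)
pose g : R := (m.*2 - l.+1).*2.+1%:R * f0.
have fg : f = pi - g.
  have e : (m.*2.*2 = l.*2.+1 + (m.*2 - l.+1).*2.+1)%N by lia.
  by rewrite [in RHS]pf0 e natrD /f /g; ring.
have cf : cos f = - cos g by rewrite fg addrC cosDpi cosN.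
have sf : sin f = sin g by rewrite fg addrC sinDpi sinN opprK.
right; rewrite cf sf opprK [X in _ <= t * X](eq_bigr (fun l : 'I_k => `|cos g + x l * sin g|)).
  by apply: (@zden_le_znum_cot g f0) => //; apply: mid; lia.
by move=> i _; rewrite -normrN; congr `|_|; ring.
Qed.

End ZolotarevPolynomials.

(** * The Hermitian form of a positive definite matrix *)

Section HermitianForm.
Local Open Scope complex_scope.
Local Open Scope sesquilinear_scope.
Local Open Scope ring_scope.
Variable R : realType.
Local Notation C := R[i].

Section Fixed.
Variables (n : nat) (H : 'M[R]_n).
Local Notation HC := (map_mx (real_complex R) H).

Definition qform (v : 'rV[C]_n) : C := (v *m HC *m v ^t*) 0 0.
Definition qnorm (v : 'rV[C]_n) : C := \sum_i `|v 0 i| ^+ 2.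

Lemma qformE v : qform v = \sum_i \sum_j v 0 i * (v 0 j)^* * (H i j)%:C.
Proof.
rewrite /qform mxE exchange_big/=; apply: eq_bigr => j _.
rewrite !mxE mulr_suml; apply: eq_bigr => i _.
by rewrite !mxE; ring.
Qed.

(** The value on a complex vector is the sum of the values on its real and imaginary
    parts, by symmetry of H. *)
Lemma qform_ge0 v : posdefmx H -> 0 <= qform v.
Proof.
move=> [Hsym Hpos].
have Hs i j : H j i = H i j by rewrite -[in LHS]Hsym mxE.
have pos (u : 'rV[R]_n) : 0 <= \sum_i \sum_j u 0 i * u 0 j * H i j.
  have -> : \sum_i \sum_j u 0 i * u 0 j * H i j = (u^T^T *m H *m u^T) 0 0.
    rewrite mxE exchange_big/=; apply: eq_bigr => j _.
    by rewrite !mxE mulr_suml; apply: eq_bigr => i _; rewrite !mxE; ring.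
  have [->|u0] := eqVneq u^T 0; first by rewrite mulmx0 mxE.
  exact/ltW/Hpos.
pose a : 'rV[R]_n := \row_i complex.Re (v 0 i).
pose b : 'rV[R]_n := \row_i complex.Im (v 0 i).
have -> : qform v = (\sum_i \sum_j a 0 i * a 0 j * H i j +
                     \sum_i \sum_j b 0 i * b 0 j * H i j)%:C +
   'i%C * (\sum_i \sum_j b 0 i * a 0 j * H i j - \sum_i \sum_j a 0 i * b 0 j * H i j)%:C.
  rewrite qformE -big_split/= -sumrB !rmorph_sum/= mulr_sumr -big_split/=.
  apply: eq_bigr => i _; rewrite -big_split/= -sumrB !rmorph_sum/= mulr_sumr -big_split/=.
  apply: eq_bigr => j _; rewrite !mxE.
  case: (v 0 i) (v 0 j) => [x y] [z w].
  have -> : (z +i* w : C)^* = z +i* (- w) by [].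
  by apply/eqP; rewrite eq_complex/=; apply/andP; split; apply/eqP; ring.
have -> : \sum_i \sum_j b 0 i * a 0 j * H i j = \sum_i \sum_j a 0 i * b 0 j * H i j.
  rewrite exchange_big/=; apply: eq_bigr => i _; apply: eq_bigr => j _.
  by rewrite Hs; ring.
by rewrite subrr mulr0 addr0 lecR addr_ge0.
Qed.

Hypothesis Hpd : posdefmx H.

Let HCh : HC \is hermsymmx.
Proof.
apply: realsym_hermsym.
  apply/is_hermitianmxP; rewrite expr0 scale1r map_mx_id//.
  by apply/matrixP => i j; rewrite !mxE -[in LHS]Hpd.1 mxE.
by apply/mxOverP => i j; rewrite mxE; apply/complex_realP; exists (H i j).
Qed.

Definition eigval i := complex.Re (spectral_diag HC 0 i).
Definition eigcoord (v : 'rV[C]_n) : 'rV[C]_n := v *m (spectralmx HC) ^t*.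

Lemma eigvalC i : spectral_diag HC 0 i = (eigval i)%:C.
Proof.
have /mxOverP dreal := hermitian_spectral_diag_real HCh.
by rewrite /eigval RRe_real.
Qed.

Lemma HC_spectral : HC = (spectralmx HC) ^t* *m diag_mx (spectral_diag HC) *m spectralmx HC.
Proof.
have /hermitian_normalmx/orthomx_spectralP E := HCh.
by rewrite {1}E invmx_unitary ?spectral_unitarymx.
Qed.

Lemma qform_spectral v : qform v = \sum_i (eigval i)%:C * `|eigcoord v 0 i| ^+ 2.
Proof.
rewrite /qform {1}HC_spectral !mulmxA -mulmxA -/(eigcoord v).
have -> : spectralmx HC *m v ^t* = (eigcoord v) ^t*.
  by rewrite /eigcoord trmx_mul map_mxM trmxCK.
rewrite mxE; apply: eq_bigr => i _.
by rewrite mul_mx_diag !mxE eigvalC sqr_normc; ring.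
Qed.

Lemma qnormE v : qnorm v = (v *m v ^t*) 0 0.
Proof. by rewrite mxE; apply: eq_bigr => i _; rewrite !mxE sqr_normc. Qed.

Lemma qnorm_spectral v : qnorm v = qnorm (eigcoord v).
Proof.
rewrite !qnormE /eigcoord trmx_mul map_mxM trmxCK !mulmxA.
by rewrite mulmxKtV// spectral_unitarymx.
Qed.

(** An eigenvalue is the value of the form at a unit eigenvector. *)
Lemma eigval_ge0 i : 0 <= eigval i.
Proof.
have := qform_ge0 (row i (spectralmx HC)) Hpd.
have -> : qform (row i (spectralmx HC)) = (eigval i)%:C; last by rewrite lecR.
have E : eigcoord (row i (spectralmx HC)) = row i 1%:M.
  by rewrite /eigcoord -row_mul (unitarymxP _) ?spectral_unitarymx.
rewrite qform_spectral E (bigD1 i)//= big1 ?addr0 => [|j ji].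
  by rewrite !mxE eqxx normr1 expr1n mulr1.
by rewrite !mxE eq_sym (negbTE ji) normr0 expr0n mulr0.
Qed.

End Fixed.
End HermitianForm.

(** * Singular values, eigenvalues and dimension counts *)

Section SortedCount.
Variable R : realType.
Implicit Types (s : seq R).

Lemma count_gt_nth s a : sorted >=%R s -> (a < size s)%N ->
  (count (fun y => (nth 0 s a < y)%R) s <= a)%N.
Proof.
move=> ss sa; rewrite -{2}(cat_take_drop a s) count_cat.
have -> : count (fun y => nth 0 s a < y) (drop a s) = 0%N.
  apply/eqP; rewrite -leqn0 leqNgt -has_count; apply/hasPn => y ys; case: (nthP (0 : R) ys) => i.
  rewrite size_drop nth_drop => ilt <-; rewrite -leNgt.
  by apply: (sorted_leq_nth ge_trans ge_refl) => //; rewrite ?inE ?leq_addr// -ltn_subRL.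
by rewrite addn0 (leq_trans (count_size _ _))// size_take sa.
Qed.

Lemma count_lt_nth s a : sorted >=%R s -> (a < size s)%N ->
  (count (fun y => (y < nth 0 s a)%R) s <= size s - a.+1)%N.
Proof.
move=> ss sa; rewrite -{2}(cat_take_drop a.+1 s) count_cat.
have -> : count (fun y => y < nth 0 s a) (take a.+1 s) = 0%N.
  apply/eqP; rewrite -leqn0 leqNgt -has_count; apply/hasPn => y ys; case: (nthP (0 : R) ys) => i.
  rewrite size_takel// ltnS => ia; rewrite nth_take// => <-; rewrite -leNgt.
  by apply: (sorted_leq_nth ge_trans ge_refl) => //; rewrite ?inE// (leq_ltn_trans ia).
by rewrite add0n (leq_trans (count_size _ _))// size_drop.
Qed.

End SortedCount.

Section Spectrum.
Local Open Scope complex_scope.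
Local Open Scope sesquilinear_scope.
Local Open Scope ring_scope.
Variables (R : realType) (n : nat) (H : 'M[R]_n).
Local Notation C := R[i].
Local Notation HC := (map_mx (real_complex R) H).
Hypothesis Hpd : posdefmx H.

Lemma singular_values_ge0 s : s \in singular_values H -> 0 <= s.
Proof. by rewrite mem_sort => /mapP[x _ ->]; exact: sqrtr_ge0. Qed.

Lemma singval_ge0 j : 0 <= singval H j.
Proof.
rewrite /singval; have [lt|ge] := ltnP j.-1 (size (singular_values H)).
  by rewrite singular_values_ge0// mem_nth.
by rewrite nth_default.
Qed.

(** As H is symmetric, the squares of both lists are the roots of the characteristic
    polynomial of H^2; both lists are nonnegative. *)
Lemma singular_values_eigval :
  perm_eq (singular_values H) [seq eigval H i | i <- enum 'I_n].
Proof.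
have E : \prod_(s <- singular_values H) ('X - ((s ^+ 2)%:C)%:P) =
    \prod_(i < n) ('X - ((eigval H i ^+ 2)%:C)%:P) :> {poly C}.
  transitivity (map_poly (real_complex R) (char_poly (H^T *m H))).
    rewrite singular_valuesP rmorph_prod; apply: eq_bigr => s _.
    by rewrite rmorphB/= map_polyX map_polyC.
  rewrite Hpd.1 map_char_poly map_mxM.
  have U := spectral_unitarymx HC.
  have -> : HC *m HC = invmx (spectralmx HC) *m
      (diag_mx (spectral_diag HC) *m diag_mx (spectral_diag HC)) *m spectralmx HC.
    rewrite invmx_unitary// [in LHS](HC_spectral Hpd) !mulmxA mulmxtVK//.
  rewrite char_poly_similar ?spectral_unit//.
  rewrite char_poly_trig ?mulmx_diag ?diag_mx_is_trig//.
  apply: eq_bigr => i _; rewrite !mxE eqxx mulr1n.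
  by rewrite eigvalC// rmorphXn/= expr2.
have P : perm_eq [seq (s ^+ 2)%:C | s <- singular_values H]
                 [seq (eigval H i ^+ 2)%:C | i <- enum 'I_n].
  by apply: prod_XsubC_eq; rewrite !big_map.
have := perm_map (fun z : C => Num.sqrt (complex.Re z)) P.
have -> : map (fun z : C => Num.sqrt (complex.Re z)) [seq (s ^+ 2)%:C | s <- singular_values H] =
    singular_values H.
  rewrite -map_comp -[RHS]map_id; apply/eq_in_map => s /singular_values_ge0 s0 /=.
  by rewrite sqrtr_sqr ger0_norm.
suff -> : map (fun z : C => Num.sqrt (complex.Re z))
    [seq (eigval H i ^+ 2)%:C | i <- enum 'I_n] = [seq eigval H i | i <- enum 'I_n] by [].
rewrite -map_comp; apply: eq_map => i /=.
by rewrite sqrtr_sqr ger0_norm ?eigval_ge0.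
Qed.

Lemma card_eigval (P : pred R) : #|[pred i | P (eigval H i)]| = count P (singular_values H).
Proof.
rewrite (permP singular_values_eigval) count_map -sum1_card -sum1_count.
by rewrite big_enum_cond.
Qed.

Lemma card_eigval_gt j : (0 < j <= n)%N ->
  (#|[pred i | (singval H j < eigval H i)%R]| <= j.-1)%N.
Proof.
move=> /andP[j0 jn]; rewrite (card_eigval (fun y => singval H j < y)).
apply: count_gt_nth; first exact: (sort_sorted ge_total).
by rewrite size_singular_values prednK.
Qed.

Lemma card_eigval_lt j : (0 < j <= n)%N ->
  (#|[pred i | (eigval H i < singval H j)%R]| <= n - j)%N.
Proof.
move=> /andP[j0 jn]; rewrite (card_eigval (fun y => y < singval H j)).
apply: (leq_trans (count_lt_nth _ _)); first exact: (sort_sorted ge_total).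
  by rewrite size_singular_values prednK.
by rewrite size_singular_values prednK.
Qed.

End Spectrum.

Section Kernel.
Variable (F : fieldType).

(** Fewer linear conditions than coefficients. *)
Lemma poly_kernel r c (f : {poly F} -> 'rV[F]_c) : linear f -> (c < r)%N ->
  exists2 g : {poly F}, g != 0 & (size g <= r)%N /\ f g = 0.
Proof.
move=> lf cr.
pose fl : {linear {poly F} -> 'rV[F]_c} :=
  HB.pack f (GRing.isLinear.Build _ _ _ _ f lf).
pose T := lin1_mx (fl \o rVpoly : 'rV[F]_r -> 'rV[F]_c).
have : kermx T != 0.
  rewrite -mxrank_eq0 mxrank_ker -lt0n subn_gt0.
  exact: leq_ltn_trans (rank_leq_col _) cr.
move=> /rowV0Pn[v /sub_kermxP vT v0].
exists (rVpoly v); last first.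
  by split; [exact: size_poly|rewrite mul_rV_lin1 in vT].
by apply: contra v0 => /eqP e; rewrite -(rVpolyK v) e linear0.
Qed.

End Kernel.

(** * Comparison of the Hankel form on two families of polynomials *)

Section HankelForm.
Local Open Scope complex_scope.
Local Open Scope sesquilinear_scope.
Local Open Scope ring_scope.
Variables (R : realType) (n : nat) (H : 'M[R]_n) (h : nat -> R).
Local Notation C := R[i].
Hypothesis Hh : forall i j : 'I_n, H i j = h (i.+1 + j.+1)%N.

(** The functional sending 'X^a to h_(a+2) for a < 2 n; the shift by 2 comes from
    numbering rows and columns from 1. *)
Definition moment (p : {poly C}) : C := \sum_(a < n + n) p`_a * (h a.+2)%:C.

Lemma momentD p q : moment (p + q) = moment p + moment q.
Proof. by rewrite /moment -big_split/=; apply: eq_bigr => a _; rewrite coefD mulrDl. Qed.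

Lemma coef_mul_wide (p q : {poly C}) a : (size p <= n)%N -> (size q <= n)%N ->
  (p * q)`_a = \sum_(i < n) \sum_(j < n) p`_i * q`_j * (i + j == a)%N%:R.
Proof.
move=> pn qn.
have e (r : {poly C}) : (size r <= n)%N -> r = \sum_(i < n) r`_i *: 'X^i.
  by move=> rn; rewrite -poly_def; apply/polyP => i; rewrite coef_poly;
     case: ltnP => // ni; rewrite nth_default// (leq_trans rn).
rewrite {1}(e p pn) {1}(e q qn) mulr_suml coef_sum; apply: eq_bigr => i _.
rewrite mulr_sumr coef_sum; apply: eq_bigr => j _.
by rewrite -scalerAl -scalerAr -exprD !coefZ coefXn mulrA eq_sym.
Qed.

Lemma qform_moment (p : {poly C}) : (size p <= n)%N ->
  qform H (poly_rV p) = moment (p * map_poly Num.conj p).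
Proof.
move=> pn; rewrite qformE /moment.
have cn : (size (map_poly Num.conj p) <= n)%N by rewrite size_map_poly.
transitivity (\sum_(a < n + n) \sum_(i < n) \sum_(j < n)
    p`_i * (p`_j)^* * (i + j == a)%N%:R * (h a.+2)%:C).
  rewrite [RHS]exchange_big/=; apply: eq_bigr => i _; rewrite [RHS]exchange_big/=; apply: eq_bigr => j _.
  have ij : (i + j < n + n)%N by rewrite -addnS leq_add// ltnW.
  rewrite (bigD1 (Ordinal ij))//= big1 ?addr0; last first.
    move=> a aij; rewrite (_ : _ == _ = false) ?mulr0 ?mul0r//.
    by apply: contraNF aij => /eqP e; apply/eqP/val_inj.
  by rewrite eqxx mulr1 !mxE Hh addSn addnS.
apply: eq_bigr => a _; rewrite coef_mul_wide// mulr_suml; apply: eq_bigr => i _.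
by rewrite mulr_suml; apply: eq_bigr => j _; rewrite coef_map.
Qed.

(** The form at p is a linear function of p times its conjugate, and
    (d g)(d g)^ * is d^2 g g^ * for d with real coefficients. *)
Lemma qform_split (d e f g : {poly C}) :
  map_poly Num.conj d = d -> map_poly Num.conj e = e -> map_poly Num.conj f = f ->
  d ^+ 2 = e ^+ 2 + f ^+ 2 ->
  (size (d * g)%R <= n)%N -> (size (e * g)%R <= n)%N -> (size (f * g)%R <= n)%N ->
  qform H (poly_rV (d * g)) = qform H (poly_rV (e * g)) + qform H (poly_rV (f * g)).
Proof.
move=> dd ee ff def dn en fn; rewrite !qform_moment// !rmorphM/= dd ee ff -momentD.
congr moment; rewrite !(mulrACA _ g) -!expr2 def; ring.
Qed.

End HankelForm.

Section ShiftBound.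
Local Open Scope complex_scope.
Local Open Scope sesquilinear_scope.
Local Open Scope ring_scope.
Variables (R : realType) (n : nat) (H : 'M[R]_n).
Local Notation C := R[i].
Local Notation HC := (map_mx (real_complex R) H).

Lemma qnorm_poly (p : {poly C}) N : (size p <= N)%N -> (N <= n)%N ->
  qnorm (poly_rV p : 'rV[C]_n) = \sum_(a < N) `|p`_a| ^+ 2.
Proof.
move=> pN Nn; rewrite /qnorm.
transitivity (\sum_(i < N + (n - N)) `|p`_i| ^+ 2).
  by rewrite subnKC//; apply: eq_bigr => i _; rewrite mxE.
rewrite big_split_ord/= [X in _ + X]big1 ?addr0// => i _.
by rewrite nth_default ?normr0 ?expr0n// (leq_trans pN)// leq_addr.
Qed.

Lemma qnorm_le (p q : {poly C}) N (s : R) : (0 < N)%N -> (N <= n)%N -> 0 <= s ->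
  (size p <= N)%N -> (size q <= N)%N ->
  (forall l, (l < N)%N -> `|p.[rootN1 R N l]| <= s%:C * `|q.[rootN1 R N l]|) ->
  qnorm (poly_rV p : 'rV[C]_n) <= (s ^+ 2)%:C * qnorm (poly_rV q : 'rV[C]_n).
Proof.
move=> N0 Nn s0 pN qN pq; rewrite !(@qnorm_poly _ N)//.
have NC : 0 < N%:R :> C by rewrite ltr0n.
rewrite -(ler_pM2l NC) mulrCA -!parseval// mulr_sumr; apply: ler_sum => l _.
rewrite rmorphXn -exprMn/= lerXn2r ?nnegrE ?normr_ge0//.
  by rewrite mulr_ge0// lecR.
exact: pq.
Qed.

(** The polynomial g is chosen so that D g is orthogonal to the eigenvectors with
    eigenvalue > sigma_j and N g to those with eigenvalue < sigma_i.  Then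
    sigma_i |N g|^2 <= H(N g) <= H(D g) <= sigma_j |D g|^2 <= (2 t)^2 sigma_j |N g|^2. *)
Lemma singval_shift k (x : nat -> R) m (t : R) (B := m.*2.*2%:R / pi) i j :
  hankel H -> posdefmx H -> (forall l, 0 < x l) -> 0 <= t ->
  (forall y, B^-1 <= y <= B -> \prod_(l < k) `|(y - x l) / (y + x l)| <= t) ->
  (0 < m)%N -> (m.*2 <= n)%N -> (0 < i <= n)%N -> (0 < j <= n)%N ->
  (j.-1 + (n - i) < m.*2 - k.*2)%N ->
  singval H i <= (2 * t) ^+ 2 * singval H j.
Proof.
move=> [h Hh] Hpd x0 t0 xt m0 mn iP jP cnt.
pose D := zden k x; pose N := znum k x; pose E := zrem k x.
pose A1 := [pred a | (singval H j < eigval H a)%R].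
pose A2 := [pred a | (eigval H a < singval H i)%R].
pose f (g : {poly C}) : 'rV[C]_(#|A1| + #|A2|) :=
  row_mx (\row_b eigcoord H (poly_rV (D * g)) 0 (enum_val (A := A1) b))
         (\row_b eigcoord H (poly_rV (N * g)) 0 (enum_val (A := A2) b)).
have el a u v : eigcoord H (a *: u + v) = a *: eigcoord H u + eigcoord H v.
  by rewrite /eigcoord mulmxDl -scalemxAl.
have lf : linear f.
  move=> a p q; rewrite /f scale_row_mx add_row_mx; congr row_mx; apply/rowP => b;
  by rewrite [LHS]mxE mulrDr -scalerAr linearP el !mxE.
have cr : (#|A1| + #|A2| < m.*2 - k.*2)%N.
  apply: leq_ltn_trans cnt; apply: leq_add.
    exact: card_eigval_gt.
  exact: card_eigval_lt.
have [g g0 [gs fg]] := poly_kernel lf cr.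
have [f1 f2] : (\row_b eigcoord H (poly_rV (D * g)) 0 (enum_val (A := A1) b) = 0) /\
               (\row_b eigcoord H (poly_rV (N * g)) 0 (enum_val (A := A2) b) = 0).
  by apply: eq_row_mx; rewrite -/(f g) fg row_mx0.
have y1 a : singval H j < eigval H a -> eigcoord H (poly_rV (D * g)) 0 a = 0.
  move=> ja; have aA : a \in A1 by rewrite inE.
  have /rowP/(_ (enum_rank_in aA a)) := f1.
  by rewrite !mxE enum_rankK_in.
have y2 a : eigval H a < singval H i -> eigcoord H (poly_rV (N * g)) 0 a = 0.
  move=> ja; have aA : a \in A2 by rewrite inE.
  have /rowP/(_ (enum_rank_in aA a)) := f2.
  by rewrite !mxE enum_rankK_in.
have [sD sN sE] := size_zden_znum_zrem k x.
have sz (d : {poly C}) : (size d <= k.*2.+1)%N -> (size (d * g)%R <= m.*2)%N.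
  move=> sd; apply: leq_trans (size_polyMleq _ _) _.
  rewrite -subn1 leq_subLR add1n (leq_trans (leq_add sd gs))//.
  by rewrite addSn subnKC//; have := cr; lia.
have szn (d : {poly C}) : (size d <= k.*2.+1)%N -> (size (d * g)%R <= n)%N.
  by move=> /sz/leq_trans; apply.
have split : qform H (poly_rV (D * g)) = qform H (poly_rV (N * g)) + qform H (poly_rV (E * g)).
  apply: (qform_split Hh); rewrite ?szn//;
    [exact: map_zden|exact: map_znum|exact: map_zrem|exact: zden_sqr].
have up : qform H (poly_rV (D * g)) <= (singval H j)%:C * qnorm (poly_rV (D * g) : 'rV[C]_n).
  rewrite qform_spectral// (qnorm_spectral H) mulr_sumr; apply: ler_sum => a _.
  have [le|lt] := leP (eigval H a) (singval H j).
    by rewrite ler_wpM2r ?exprn_ge0 ?normr_ge0 ?lecR.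
  by rewrite y1// normr0 expr0n !mulr0.
have lo : (singval H i)%:C * qnorm (poly_rV (N * g) : 'rV[C]_n) <= qform H (poly_rV (N * g)).
  rewrite qform_spectral// (qnorm_spectral H) mulr_sumr; apply: ler_sum => a _.
  have [le|lt] := leP (singval H i) (eigval H a).
    by rewrite ler_wpM2r ?exprn_ge0 ?normr_ge0 ?lecR.
  by rewrite y2// normr0 expr0n !mulr0.
have m20 : (0 < m.*2)%N by rewrite double_gt0.
have nD : qnorm (poly_rV (D * g) : 'rV[C]_n) <= ((2 * t) ^+ 2)%:C * qnorm (poly_rV (N * g) : 'rV[C]_n).
  apply: (@qnorm_le _ _ m.*2); rewrite ?sz ?mulr_ge0// => l lm.
  rewrite (hornerM D g) (hornerM N g) !normrM mulrA ler_wpM2r ?normr_ge0//.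
  exact: zden_le_znum_rootN1.
have q0 (p : {poly C}) : 0 <= qnorm (poly_rV p : 'rV[C]_n).
  by apply: sumr_ge0 => a _; rewrite exprn_ge0.
have Dpos : 0 < qnorm (poly_rV (D * g) : 'rV[C]_n).
  rewrite lt_neqAle q0 andbT eq_sym; apply/negP => /eqP Z.
  have : D * g = 0.
    apply/polyP => a; rewrite coef0; have [an|an] := ltnP a n; last first.
      by rewrite nth_default// (leq_trans _ an)// szn.
    move/eqP: Z; rewrite psumr_eq0 => [/allP/(_ (Ordinal an))|b _]; last by rewrite exprn_ge0.
    by rewrite mem_index_enum mxE sqrf_eq0 normr_eq0 => /(_ isT)/eqP.
  apply/eqP; rewrite mulf_neq0//; exact: zden_neq0.
have Npos : 0 < qnorm (poly_rV (N * g) : 'rV[C]_n).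
  rewrite lt_neqAle q0 andbT eq_sym; apply/negP => /eqP Z.
  by have := lt_le_trans Dpos nD; rewrite Z mulr0 ltxx.
rewrite -lecR -(ler_pM2r Npos); apply: le_trans lo _.
apply: le_trans (_ : qform H (poly_rV (D * g)) <= _).
  by rewrite split lerDl qform_ge0.
apply: le_trans up _.
have sj : 0 <= (singval H j)%:C by rewrite lecR singval_ge0.
apply: le_trans (ler_wpM2l sj nD) _.
by rewrite mulrA [X in X * _ <= _]mulrC [in leRHS](rmorphM (real_complex R)).
Qed.

End ShiftBound.

(** * The bounds *)

Section Bounds.
Variables (R : realType).

Lemma four_mul_div_pi_ge1 m : (0 < m)%N -> 1 <= m.*2.*2%:R / pi :> R.
Proof.
move=> m0; rewrite ler_pdivlMr ?pi_gt0// mul1r !natr_double.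
have : 1 <= m%:R :> R by rewrite ler1n.
by have := @pihalf_lt2 R; rewrite ltr_pdivrMr//; lra.
Qed.

Lemma ln_eight_div_piE m : ln (8 * m%:R / pi) = ln (2 * (m.*2.*2%:R / pi)) :> R.
Proof. by rewrite !natr_double; congr ln; ring. Qed.

Lemma ln_eight_div_pi_gt0 m : (0 < m)%N -> 0 < ln (8 * m%:R / pi) :> R.
Proof.
by move=> /four_mul_div_pi_ge1 B1; rewrite ln_eight_div_piE ln_gt0//; lra.
Qed.

(** k + 1 steps of two indices are paid for by k nodes: the spare step covers the
    loss of one dimension when n is odd. *)
Lemma singval_hankel_le n (H : 'M[R]_n) j k :
  (2 <= n)%N -> hankel H -> posdefmx H -> (0 < j)%N -> (j + 2 * k.+1 <= n)%N ->
  singval H (j + 2 * k.+1) <=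
  16 * expR (- (pi ^+ 2 * k%:R / (2 * ln (8 * (n %/ 2)%N%:R / pi)))) * singval H j.
Proof.
move=> n2 Hh Hpd j0 jkn; pose m := (n %/ 2)%N; rewrite -/m.
have m0 : (0 < m)%N by rewrite divn_gt0.
have [x x0 xt] := @zolotarev_nodes R (m.*2.*2%:R / pi) k (four_mul_div_pi_ge1 m0).
rewrite -ln_eight_div_piE in xt.
have L0 := ln_eight_div_pi_gt0 m0; move: (ln _) L0 xt => L L0.
set t := 2 * expR _ => xt.
have -> : 16 * expR (- (pi ^+ 2 * k%:R / (2 * L))) = (2 * t) ^+ 2.
  have -> : - (pi ^+ 2 * k%:R / (2 * L)) = 2%:R * - (pi ^+ 2 * k%:R / (4 * L)).
    by move: (pi : R) => p; field; rewrite gt_eqF.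
  by rewrite expRM_natl /t; ring.
apply: (singval_shift Hh Hpd x0 _ xt) => //.
- by rewrite mulr_ge0// expR_ge0.
- by rewrite /m; lia.
- by lia.
- by lia.
- by rewrite /m; lia.
Qed.

End Bounds.

Theorem corollary5p4 (R : realType) (n : nat) (H : 'M[R]_n)
    (n_ge2 : (2 <= n)%N) (H_hankel : hankel H) (H_posdef : posdefmx H) :
  (forall j k : nat, (1 <= j)%N -> (1 <= j + 2 * k <= n)%N ->
     singval H (j + 2 * k) <=
       16 * expR (pi ^+ 2 / (4 * ln (8 * (n %/ 2)%N%:R / pi))) ^ (- 2 * k%:Z + 2)
          * singval H j) /\
  (forall eps : R, 0 < eps < 1 ->
     (eps_rank eps H)%:Z <=
       2 * Num.ceil (2 * ln (8 * (n %/ 2)%N%:R / pi) * ln (16 / eps) / pi ^+ 2)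
         + 2).
Proof.
have L0 : 0 < ln (8 * (n %/ 2)%N%:R / pi) :> R by apply: ln_eight_div_pi_gt0; rewrite divn_gt0.
have bound := fun j k => @singval_hankel_le R n H j k n_ge2 H_hankel H_posdef.
move: (ln (8 * (n %/ 2)%N%:R / pi)) L0 bound => L L0 bound.
split=> [j k j0 /andP[_ jkn]|eps /andP[eps0 eps1]].
  (* for k = 0 the right-hand side is at least the singular value itself *)
  case: k jkn => [|k] jkn.
    rewrite muln0 addn0 mulr0 add0r ler_peMl ?singval_ge0//.
    have e1 : 1 <= expR (pi ^+ 2 / (4 * L)).
      by rewrite -expR0 ler_expR divr_ge0 ?sqr_ge0// mulr_ge0// ltW.
    have : 1 <= expR (pi ^+ 2 / (4 * L)) ^+ 2 by rewrite expr_ge1// ltW// expR_gt0.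
    by rewrite -exprnP; lra.
  have -> : - 2 * k.+1%:Z + 2 = - (2 * k)%N%:Z by lia.
  rewrite -exprnN -expRM_natl -expRN.
  have -> : - ((2 * k)%N%:R * (pi ^+ 2 / (4 * L))) = - (pi ^+ 2 * k%:R / (2 * L)).
    by rewrite natrM; move: (pi : R) => p; field; rewrite gt_eqF.
  exact: bound.
have [_ rank_min] := eps_rankP H (ltW eps0).
set c := Num.ceil _.
have l0 : 0 < ln (16 / eps) by rewrite ln_gt0// ltr_pdivlMr// mul1r; lra.
have a0 : 0 <= 2 * L * ln (16 / eps) / pi ^+ 2.
  by rewrite divr_ge0 ?sqr_ge0// !mulr_ge0// ltW.
have c0 : 0 <= c by rewrite /c -(@ler_int R) (le_trans a0)// ceil_ge.
pose k := `|c|%N.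
have ck : c = k%:Z by rewrite /k gez0_abs.
suff : (eps_rank eps H <= 2 * k.+1)%N by rewrite ck; lia.
apply: rank_min.
(* beyond n the singular value is 0 by convention *)
have [lt|ge] := ltnP (2 * k.+1) n; last first.
  rewrite {1}/singval nth_default ?size_singular_values//.
  by rewrite mulr_ge0 ?singval_ge0// ltW.
have := bound 1%N k isT.
rewrite add1n => /(_ lt)/le_trans; apply.
rewrite ler_wpM2r ?singval_ge0//.
have ca : 2 * L * ln (16 / eps) / pi ^+ 2 <= k%:R.
  have := ceil_ge (2 * L * ln (16 / eps) / pi ^+ 2); rewrite -/c ck.
  by [].
have : expR (- (pi ^+ 2 * k%:R / (2 * L))) <= expR (- ln (16 / eps)).
  rewrite ler_expR lerN2 ler_pdivlMr ?mulr_gt0//.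
  by move: ca; rewrite ler_pdivrMr ?exprn_gt0 ?pi_gt0//; lra.
by rewrite -lnV ?posrE ?divr_gt0// invf_div lnK ?posrE ?divr_gt0//; lra.
Qed.
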